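(* Let $\alpha\in(0,1)$ be irrational and let $(\Omega(\alpha),T)$ be the Sturmian subshift with rotation number $\alpha$. Then $(\Omega(\alpha),T)$ satisfies the leading sequence condition (LSC) with $r=2$ and leading sequences $\omega^{(1)}=u_\alpha$ and $\omega^{(2)}=v_\alpha$.
   Context: Sturmian subshifts. Let $\alpha=[a_1,a_2,\ldots]=\cfrac{1}{a_1+\cfrac{1}{a_2+\cdots}}$ be the continued fraction expansion of the irrational number $\alpha$. Define words over $\{0,1\}$ by $s_{-1}=1$, $s_0=0$, $s_1=s_0^{a_1-1}s_{-1}$, $s_n=s_{n-1}^{a_n}s_{n-2}$ for $n\ge2$. Let $\mathcal{W}(\alpha)$ be the set of all finite words occurring in some $s_n$, and $\Omega(\alpha)=\{\omega\in\{0,1\}^{\mathbb{Z}}:$ every finite word occurring in $\omega$ belongs to $\mathcal{W}(\alpha)\}$, with shift $(T\omega)(n)=\omega(n+1)$. For $n\ge2$, $s_{n-1}$ is a prefix of $s_n$, so the one-sided right-infinite word $c_\alpha=\lim_n s_n$ exists (indexed by $\mathbb{N}=\{1,2,\ldots\}$). For $n\ge2$, $s_{n-1}$ is a suffix of $s_{n+1}$, so the left-infinite words $d_\alpha=\lim_n s_{2n}$ and $e_\alpha=\lim_n s_{2n+1}$ exist (limits of words aligned at their right end, indexed by $-\mathbb{N}\cup\{0\}$). The two-sided word $u_\alpha$ agrees with $c_\alpha$ on $\mathbb{N}$ and with $d_\alpha$ on $-\mathbb{N}\cup\{0\}$; $v_\alpha$ agrees with $c_\alpha$ on $\mathbb{N}$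 and with $e_\alpha$ on $-\mathbb{N}\cup\{0\}$. Both belong to $\Omega(\alpha)$. $\mathcal{W}(\Omega)_n$ denotes the set of all words $\omega(k)\ldots\omega(k+n-1)$ with $\omega\in\Omega$, $k\in\mathbb{Z}$. A function $A$ on $\Omega$ is locally constant if there is $N\in\mathbb{N}$ such that $A(\omega)=A(\varrho)$ whenever $\omega(-N)\ldots\omega(N)=\varrho(-N)\ldots\varrho(N)$. For $A:\Omega\to SL(2,\mathbb{R})$ the cocycle is $A(n,\omega)=A(T^{n-1}\omega)\cdots A(\omega)$ for $n>0$, $A(0,\omega)=\mathrm{Id}$, and $A(n,\omega)=A(T^{n}\omega)^{-1}\cdots A(T^{-1}\omega)^{-1}$ for $n<0$. $\|\cdot\|$ is the operator norm induced by the Euclidean norm on $\mathbb{R}^2$. A subshift $(\Omega,T)$ satisfies (LSC) with leading sequences $\omega^{(1)},\ldots,\omega^{(r)}\in\Omega$ if: ($\alpha$) there is $N\in\mathbb{N}$ with $\mathcal{W}(\Omega)_n=\bigcup_{j=1}^r\{\omega^{(j)}(-k+1)\ldots\omega^{(j)}(-k+n):k=0,\ldots,n\}$ for all $n\ge N$; and for every locally constant $A:\Omega\to SL(2,\mathbb{R})$: ($\beta$) for every $j$ the limits $\lim_{n\to\infty}\frac{\log\|A(n,\omega^{(j)})\|}{|n|}$ and $\lim_{n\to-\infty}\frac{\log\|A(n,\omega^{(j)})\|}{|n|}$ exist, and all these limits (over all $j$ and both signs) have the same value; ($\gamma$) for every $j$ and every $v\in\mathbb{R}^2\setminus\{0\}$,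 at most one of the two limits $\lim_{n\to\pm\infty}\frac1{|n|}\log\|A(n,\omega^{(j)})v\|$ is negative (i.e. it is not the case that both limits exist and are negative). *)

(* Defs.v *)
From HB Require Import structures.
From mathcomp Require Import all_boot all_order all_algebra.
From mathcomp Require Import all_classical all_reals all_analysis.
From mathcomp Require Import ring lra zify.

Set Implicit Arguments.
Unset Strict Implicit.
Unset Printing Implicit Defensive.

Import Order.TTheory GRing.Theory Num.Theory.
Import numFieldNormedType.Exports.

Local Open Scope classical_set_scope.
Local Open Scope ring_scope.

(** ** Two-sided sequences *)

(* [shiftz n] is the [n]-th iterate, [n] in Z, of the shift T. *)
Definition shiftz (S : Type) (n : int) (w : int -> S) : int -> S :=
  fun m => w (m + n).

(* The word w(k) w(k+1) ... w(k+n-1). *)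
Definition subword (S : Type) (w : int -> S) (k : int) (n : nat) : seq S :=
  mkseq (fun i => w (k + i%:Z)) n.

Definition words (S : Type) (Omega : set (int -> S)) (n : nat) : set (seq S) :=
  [set x | exists2 w, Omega w & exists k, x = subword w k n].

(** ** Cocycles *)

Definition vnorm2 (R : realType) (d : nat) (v : 'cV[R]_d) : R :=
  Num.sqrt (\sum_i v i 0 ^+ 2).

Definition opnorm2 (R : realType) (d : nat) (M : 'M[R]_d) : R :=
  sup [set vnorm2 (M *m v) | v in [set v : 'cV[R]_d | vnorm2 v <= 1]].

(* Maps from Omega to SL(2,R) are represented by functions defined on all
   sequences, whose values outside of Omega are never used: the conditions
   below only concern Omega, which is invariant under the shift and its
   inverse (see [shiftz_sturm_subshift]). *)
Definition SL2_valued (R : realType) (S : Type) (Omega : set (int -> S))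
    (A : (int -> S) -> 'M[R]_2) : Prop :=
  forall w, Omega w -> \det (A w) = 1.

Definition locally_constant_on (S T : Type) (Omega : set (int -> S))
    (A : (int -> S) -> T) : Prop :=
  exists N : nat, forall w w', Omega w -> Omega w' ->
    subword w (- N%:Z) N.*2.+1 = subword w' (- N%:Z) N.*2.+1 -> A w = A w'.

(* A(T^{n-1} w) ... A(T w) A(w) *)
Fixpoint cocycle_fwd (R : realType) (S : Type) (A : (int -> S) -> 'M[R]_2)
    (n : nat) (w : int -> S) : 'M[R]_2 :=
  if n is m.+1 then A (shiftz m%:Z w) *m cocycle_fwd A m w else 1%:M.

(* A(T^{-n} w)^{-1} ... A(T^{-1} w)^{-1} *)
Fixpoint cocycle_bwd (R : realType) (S : Type) (A : (int -> S) -> 'M[R]_2)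
    (n : nat) (w : int -> S) : 'M[R]_2 :=
  if n is m.+1 then invmx (A (shiftz (- n%:Z) w)) *m cocycle_bwd A m w
  else 1%:M.

Definition cocycle (R : realType) (S : Type) (A : (int -> S) -> 'M[R]_2)
    (n : int) (w : int -> S) : 'M[R]_2 :=
  if 0 <= n then cocycle_fwd A `|n|%N w else cocycle_bwd A `|n|%N w.

(** ** The leading sequence condition *)

Definition LSC_words (S : Type) (Omega : set (int -> S)) (r : nat)
    (omega : 'I_r -> int -> S) : Prop :=
  exists N : nat, forall n, (N <= n)%N ->
    words Omega n =
    \bigcup_(j : 'I_r)
      [set subword (omega j) (- k%:Z + 1) n | k in [set k : nat | (k <= n)%N]].

(* A locally constant A takes finitely many values, so that |A(n, w)| and
   |A(n, w)^{-1}| are at most c ^ |n| for some c: requiring the limits here and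
   in [LSC_decay] to be finite is no restriction. *)
Definition LSC_growth (R : realType) (S : Type) (r : nat)
    (omega : 'I_r -> int -> S) (A : (int -> S) -> 'M[R]_2) : Prop :=
  exists l : R, forall j,
    (ln (opnorm2 (cocycle A n%:Z (omega j))) / n%:R @[n --> \oo] --> l) /\
    (ln (opnorm2 (cocycle A (- n%:Z) (omega j))) / n%:R @[n --> \oo] --> l).

Definition LSC_decay (R : realType) (S : Type) (r : nat)
    (omega : 'I_r -> int -> S) (A : (int -> S) -> 'M[R]_2) : Prop :=
  forall j (v : 'cV[R]_2), v != 0 ->
    ~ exists l1 l2 : R,
      [/\ n%:R^-1 * ln (vnorm2 (cocycle A n%:Z (omega j) *m v))
            @[n --> \oo] --> l1,
          n%:R^-1 * ln (vnorm2 (cocycle A (- n%:Z) (omega j) *m v))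
            @[n --> \oo] --> l2,
          l1 < 0 & l2 < 0].

Definition LSC (R : realType) (S : finType) (Omega : set (int -> S)) (r : nat)
    (omega : 'I_r -> int -> S) : Prop :=
  [/\ forall j, Omega (omega j),
      LSC_words Omega omega &
      forall A : (int -> S) -> 'M[R]_2,
        SL2_valued Omega A -> locally_constant_on Omega A ->
        LSC_growth omega A /\ LSC_decay omega A].

(** ** Continued fractions *)

Fixpoint complete_quotient (R : realType) (alpha : R) (n : nat) : R :=
  if n is m.+1 then
    let x := complete_quotient alpha m in (x - (Num.truncn x)%:R)^-1
  else alpha.

(* For alpha in (0,1) irrational this is a_n in
   alpha = 1/(a_1 + 1/(a_2 + ...)), n >= 1, see [partial_quotient_cvg];
   the 0-th one, floor(alpha), is 0. *)
Definition partial_quotient (R : realType) (alpha : R) (n : nat) : nat :=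
  Num.truncn (complete_quotient alpha n).

(* The finite continued fraction 1/(a_1 + 1/(a_2 + ... + 1/a_n)). *)
Fixpoint cfrac (R : realType) (s : seq nat) : R :=
  if s is a :: s' then (a%:R + cfrac R s')^-1 else 0.

Lemma gauss_map_itv01 (R : realType) (x : R) : 0 < x < 1 -> irrational x ->
  let a := Num.truncn x^-1 in
  [/\ (0 < a)%N, 0 < x^-1 - a%:R < 1 & irrational (x^-1 - a%:R)].
Proof.
move=> /andP[x0 x1] xirr a.
have yirr : irrational (x^-1 - a%:R).
  move=> [q _ qE]; apply: xirr; exists (q + a%:R)^-1 => //.
  by rewrite fmorphV rmorphD/= qE rmorph_nat subrK invrK.
have /andP[t0 t1] : a%:R <= x^-1 < a.+1%:R by rewrite truncn_itv// invr_ge0 ltW.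
split => //; first by rewrite truncn_gt0 invf_ge1// ltW.
apply/andP; split; last by rewrite ltrBlDl natr1.
rewrite lt_neqAle subr_ge0 t0 andbT; apply/eqP => e.
by apply: yirr; rewrite -e; exists 0 => //; rewrite rmorph0.
Qed.

Lemma complete_quotientS (R : realType) (x : R) (n : nat) : 0 < x < 1 ->
  complete_quotient (x^-1 - (Num.truncn x^-1)%:R) n.+1 =
  complete_quotient x n.+2.
Proof.
have t0 (y : R) : 0 <= y -> y < 1 -> Num.truncn y = 0%N.
  by move=> y0 y1; apply/eqP; rewrite -leqn0 leqNgt truncn_gt0 -ltNge.
move=> /andP[x0 x1]; elim: n => [|n IHn]; last first.
  by rewrite [in LHS]/= -[in LHS]/(complete_quotient _ n.+1) IHn.
rewrite /= (t0 x) ?ltW// subr0.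
have /andP[a0 a1] : (Num.truncn x^-1)%:R <= x^-1 < (Num.truncn x^-1).+1%:R.
  by rewrite truncn_itv// invr_ge0 ltW.
by rewrite (t0 (_ - _)) ?subr0// ?subr_ge0// ltrBlDl natr1.
Qed.

Lemma partial_quotient1 (R : realType) (x : R) : 0 < x < 1 ->
  partial_quotient x 1 = Num.truncn x^-1.
Proof.
move=> /andP[x0 x1]; rewrite /partial_quotient/=.
suff -> : Num.truncn x = 0%N by rewrite subr0.
by apply/eqP; rewrite -leqn0 leqNgt truncn_gt0 -ltNge.
Qed.

Lemma partial_quotient_gt0 (R : realType) (alpha : R) (n : nat) :
  0 < alpha < 1 -> irrational alpha -> (0 < partial_quotient alpha n.+1)%N.
Proof.
elim: n alpha => [|n IHn] alpha a01 airr;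
  have [a0 g01 girr] := gauss_map_itv01 a01 airr.
  by rewrite partial_quotient1.
by rewrite /partial_quotient -complete_quotientS//; exact: IHn.
Qed.

Lemma cfrac_partial_quotientS (R : realType) (x : R) (n : nat) : 0 < x < 1 ->
  let a := Num.truncn x^-1 in
  cfrac R [seq partial_quotient x i | i <- iota 1 n.+1] =
  (a%:R + cfrac R [seq partial_quotient (x^-1 - a%:R) i | i <- iota 1 n])^-1.
Proof.
move=> x01 /=; rewrite partial_quotient1//; congr (_ + cfrac _ _)^-1.
rewrite (iotaDl 1 1) -map_comp; apply/eq_in_map => -[|i]; rewrite mem_iota//= => _.
by rewrite /partial_quotient complete_quotientS.
Qed.

Lemma cfrac_partial_quotient_itv01 (R : realType) (x : R) (n : nat) :
  0 < x < 1 -> irrational x ->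
  0 <= cfrac R [seq partial_quotient x i | i <- iota 1 n] <= 1.
Proof.
case: n => [|n] x01 xirr; first by rewrite /= lexx ler01.
have [a0 g01 girr] := gauss_map_itv01 x01 xirr.
elim: n x x01 xirr a0 g01 girr => [|n IHn] x x01 xirr a0 g01 girr;
  rewrite cfrac_partial_quotientS//.
  by rewrite /= addr0 invr_ge0 ler0n invf_le1 ?ltr0n// ler1n.
have [b0 h01 hirr] := gauss_map_itv01 g01 girr.
have /andP[c0 c1] := IHn _ g01 girr b0 h01 hirr.
have a1 : 1 <= (Num.truncn x^-1)%:R :> R by rewrite ler1n.
have d1 : 1 <= (Num.truncn x^-1)%:R +
  cfrac R [seq partial_quotient (x^-1 - (Num.truncn x^-1)%:R) i | i <- iota 1 n.+1] :> R.
  by apply: (le_trans a1); rewrite lerDl.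
by rewrite invr_ge0 (le_trans ler01 d1) invf_le1// (lt_le_trans ltr01 d1).
Qed.

Lemma cfrac_contract (R : realType) (a b s t : R) : 1 <= a -> 1 <= b ->
  0 <= s <= 1 -> 0 <= t <= 1 ->
  `|(a + (b + s)^-1)^-1 - (a + (b + t)^-1)^-1| <= 4^-1 * `|s - t|.
Proof.
move=> a1 b1 /andP[s0 s1] /andP[t0 t1].
have p (r : R) : 0 <= r -> 2 <= a * (b + r) + 1 by move=> ?; nra.
have -> : (a + (b + s)^-1)^-1 - (a + (b + t)^-1)^-1 =
    ((a * (b + s) + 1) * (a * (b + t) + 1))^-1 * (s - t).
  have ps := p _ s0; have pt := p _ t0.
  by field; rewrite !gt_eqF//; lra.
rewrite normrM ler_wpM2r// ger0_norm.
  rewrite lef_pV2 ?posrE; have ps := p _ s0; have pt := p _ t0; nra.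
by have ps := p _ s0; have pt := p _ t0; rewrite invr_ge0; nra.
Qed.

Lemma partial_quotient_cvg (R : realType) (alpha : R) :
  0 < alpha < 1 -> irrational alpha ->
  cfrac R [seq partial_quotient alpha i | i <- iota 1 n] @[n --> \oo] --> alpha.
Proof.
move=> a01 airr.
pose c (x : R) n := cfrac R [seq partial_quotient x i | i <- iota 1 n].
have c1 n x : 0 < x < 1 -> irrational x -> `|c x n - x| <= 1.
  move=> x01 xirr; have := cfrac_partial_quotient_itv01 n x01 xirr.
  by rewrite -/(c x n) ler_norml => /andP[? ?]; case/andP: x01; lra.
have cE n x : 0 < x < 1 -> irrational x -> `|c x n - x| <= 2 * n.+1%:R^-1.
  elim/ltn_ind: n x => -[|[|n]] IHn x x01 xirr.
  - by rewrite (le_trans (c1 _ _ x01 xirr))//; lra.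
  - by rewrite (le_trans (c1 _ _ x01 xirr))//; lra.
  have [a0 g01 girr] := gauss_map_itv01 x01 xirr.
  have cxE := cfrac_partial_quotientS n.+1 x01.
  move: a0 g01 girr cxE; set a := Num.truncn _.
  set g := x^-1 - _ => a0 g01 girr cxE.
  have [b0 h01 hirr] := gauss_map_itv01 g01 girr.
  have cgE := cfrac_partial_quotientS n g01.
  move: b0 h01 hirr cgE; set b := Num.truncn _.
  set h := g^-1 - _ => b0 h01 hirr cgE.
  have -> : c x n.+2 = (a%:R + (b%:R + c h n)^-1)^-1 by rewrite /c cxE cgE.
  rewrite [X in _ - X](_ : x = (a%:R + (b%:R + h)^-1)^-1); last first.
    have -> : b%:R + h = g^-1 by rewrite /h; ring.
    have -> : a%:R + g^-1^-1 = x^-1 by rewrite invrK /g; ring.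
    by rewrite invrK.
  have := @cfrac_contract R a%:R b%:R (c h n) h.
  rewrite !ler1n => /(_ a0 b0 (cfrac_partial_quotient_itv01 n h01 hirr)).
  case/andP: (h01) => h0 h1; rewrite (ltW h0) (ltW h1) => /(_ isT).
  move/le_trans; apply.
  have /(ler_wpM2l (_ : 0 <= 4^-1 :> R)) := IHn n (leqnSn _) h h01 hirr.
  move=> /(_ ltac:(by rewrite invr_ge0)) /le_trans; apply.
  rewrite mulrCA ler_wpM2l// -invfM lef_pV2 ?posrE ?mulr_gt0// -natrM ler_nat.
  by lia.
apply/cvgrPdist_le => e e0.
have e2 : 0 < e / 2 by rewrite divr_gt0.
have /cvgrPdist_le/(_ _ e2) := @cvg_harmonic R.
apply: filterS => n /=; rewrite sub0r normrN ger0_norm// => ne.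
rewrite distrC (le_trans (cE n alpha a01 airr))// -ler_pdivlMl// mulrC.
exact: ne.
Qed.

(** ** Sturmian subshifts *)

(* The letters 0 and 1 are [false] and [true]. *)

Definition wpow (S : Type) (x : seq S) (k : nat) : seq S := flatten (nseq k x).

Definition sturm_word_m1 : seq bool := [:: true].

Fixpoint sturm_word (R : realType) (alpha : R) (n : nat) : seq bool :=
  match n with
  | 0 => [:: false]
  | m.+1 =>
    match m with
    | 0 => wpow (sturm_word alpha m) (partial_quotient alpha n).-1
           ++ sturm_word_m1
    | p.+1 => wpow (sturm_word alpha m) (partial_quotient alpha n)
              ++ sturm_word alpha p
    end
  end.

(* The word s_{-1} = 1 need not be considered: it is a suffix of s_1. *)
Definition sturm_language (R : realType) (alpha : R) : set (seq bool) :=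
  [set x | exists n, infix x (sturm_word alpha n)].

Definition sturm_subshift (R : realType) (alpha : R) : set (int -> bool) :=
  [set w | forall k n, sturm_language alpha (subword w k n)].

(* Limits of finite words, aligned at their left end and indexed by 1, 2, ...,
   resp. aligned at their right end and indexed by 0, -1, -2, ...; these are
   letterwise limits in the discrete space [bool]. Since the lengths of the
   words considered below tend to infinity, the default letter of [nth] plays
   no role; see [c_wordE], [d_wordE] and [e_wordE]. *)
Definition lim_left_aligned (s : nat -> seq bool) (m : int) : bool :=
  lim (nth false (s n) `|m|.-1 @[n --> \oo]).

Definition lim_right_aligned (s : nat -> seq bool) (m : int) : bool :=
  lim (nth false (rev (s n)) `|m|%N @[n --> \oo]).

Definition c_word (R : realType) (alpha : R) : int -> bool :=
  lim_left_aligned (sturm_word alpha).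

Definition d_word (R : realType) (alpha : R) : int -> bool :=
  lim_right_aligned (fun n => sturm_word alpha n.*2).

Definition e_word (R : realType) (alpha : R) : int -> bool :=
  lim_right_aligned (fun n => sturm_word alpha n.*2.+1).

Definition u_word (R : realType) (alpha : R) : int -> bool :=
  fun m => if 0 < m then c_word alpha m else d_word alpha m.

Definition v_word (R : realType) (alpha : R) : int -> bool :=
  fun m => if 0 < m then c_word alpha m else e_word alpha m.

Section sturm_limits.
Variables (R : realType) (alpha : R).
Hypotheses (alpha01 : 0 < alpha < 1) (alpha_irrational : irrational alpha).
Local Notation s := (sturm_word alpha).

Lemma size_sturm_word n : (n <= size (s n) /\ 0 < size (s n))%N.
Proof.
elim/ltn_ind: n => -[|[|n]] IHn //; first by rewrite /= size_cat addn1.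
have [s1 s0] := IHn n.+1 (leqnn _); have [_ t0] := IHn n (leqnSn _).
rewrite -[s n.+2]/(wpow (s n.+1) (partial_quotient alpha n.+2) ++ s n).
move: (partial_quotient_gt0 n.+1 alpha01 alpha_irrational).
move: (s n.+1) (s n) s1 t0 => x y sx sy; case: partial_quotient => // k _.
by rewrite /wpow/= !size_cat; lia.
Qed.

Lemma prefix_sturm_word n m : (n <= m)%N -> prefix (s n.+1) (s m.+1).
Proof.
elim: m => [|m IHm]; first by rewrite leqn0 => /eqP ->; exact: prefix_refl.
rewrite leq_eqVlt => /predU1P[->|nm]; first exact: prefix_refl.
apply: (prefix_trans (IHm nm)).
rewrite -[s m.+2]/(wpow (s m.+1) (partial_quotient alpha m.+2) ++ s m).
move: (partial_quotient_gt0 m.+1 alpha01 alpha_irrational).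
by case: partial_quotient => // k _; rewrite /wpow/= -catA prefix_prefix.
Qed.

Lemma suffix_sturm_word n k : suffix (s n) (s (n + k.*2)%N).
Proof.
elim: k => [|k IHk]; first by rewrite addn0 suffix_refl.
rewrite doubleS !addnS; apply: (suffix_trans IHk).
rewrite -[s (n + k.*2).+2]/(wpow (s (n + k.*2).+1) _ ++ s (n + k.*2)%N).
exact: suffix_suffix.
Qed.

Let nth_prefix (x y : seq bool) i : prefix x y -> (i < size x)%N ->
  nth false y i = nth false x i.
Proof. by move=> /prefixP[z ->] ix; rewrite nth_cat ix. Qed.

Let lim_bool (w : nat -> bool) n b : (forall m, (n <= m)%N -> w m = b) ->
  lim (w m @[m --> \oo]) = b.
Proof.
move=> wb; apply: cvg_lim; first exact: discrete_hausdorff.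
by apply: cvg_near_cst; exists n => // m /= nm; exact: wb.
Qed.

Lemma c_wordE n i : (i < size (s n.+1))%N ->
  c_word alpha i.+1%:Z = nth false (s n.+1) i.
Proof.
move=> isn; apply: (@lim_bool _ n.+1) => -[//|m] nm /=.
by apply: nth_prefix => //; exact: prefix_sturm_word.
Qed.

Lemma d_wordE n i : (i < size (s n.*2))%N ->
  d_word alpha (- i%:Z) = nth false (rev (s n.*2)) i.
Proof.
move=> isn; apply: (@lim_bool _ n) => m nm; rewrite abszN absz_nat.
apply: nth_prefix; last by rewrite size_rev.
by rewrite prefix_rev -(subnKC nm) doubleD suffix_sturm_word.
Qed.

Lemma e_wordE n i : (i < size (s n.*2.+1))%N ->
  e_word alpha (- i%:Z) = nth false (rev (s n.*2.+1)) i.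
Proof.
move=> isn; apply: (@lim_bool _ n) => m nm; rewrite abszN absz_nat.
apply: nth_prefix; last by rewrite size_rev.
by rewrite prefix_rev -(subnKC nm) doubleD -addSn suffix_sturm_word.
Qed.

End sturm_limits.

Lemma shiftz_sturm_subshift (R : realType) (alpha : R) (n : int)
    (w : int -> bool) :
  sturm_subshift alpha w -> sturm_subshift alpha (shiftz n w).
Proof.
move=> sw k m; rewrite (_ : subword _ _ _ = subword w (k + n) m); first exact: sw.
by apply: eq_mkseq => i; rewrite /shiftz addrAC.
Qed.

(* Main.v *)
(* In every two-sided sequence of the subshift the words s_n, s_(n-1) tile. Two
   facts about them drive the proof: the words s_n s_(n-1) and s_(n-1) s_n differ
   only in their last two letters, and s_(n+1) = s_n^a s_(n-1).

   Growth: up to a bounded defect, F(x) = log |product over the word x| is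
   subadditive, and F(s_n) / |s_n| converges to some l by the recursion alone;
   tiling gives F(x) <= (l + e)|x| + K for all words x of the language. For the
   lower bound, if a >= 2 then the growth of s_n^a forces the trace over s_n to
   be of size exp((l - e)|s_n|), so that all powers s_n^b, and those of a
   rotation of s_n, grow at rate l. Any prefix of c (any suffix of d or e, up to
   two letters) is extended to such a power by at most doubling its length, and
   the upper bound applies to the piece added.

   Decay: u and v contain s_n | s_n s_n around the origin, for all n of one
   parity, and Cayley-Hamilton forbids that M^-1 v, M v and M^2 v are all small
   compared to v. *)
Require Import Defs.
From mathcomp Require Import all_boot all_order all_algebra.
From mathcomp Require Import all_classical all_reals all_analysis.
From mathcomp Require Import ring lra zify.

Set Implicit Arguments.
Unset Strict Implicit.
Unset Printing Implicit Defensive.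

Import Order.TTheory GRing.Theory Num.Theory.
Import numFieldNormedType.Exports.

Local Open Scope classical_set_scope.
Local Open Scope ring_scope.

(** ** Words *)

Section words.
Variable T : eqType.
Implicit Types (x y z : seq T) (bs : seq (seq T)).

Lemma wpowS x k : wpow x k.+1 = x ++ wpow x k.
Proof. by []. Qed.

Lemma wpowSr x k : wpow x k.+1 = wpow x k ++ x.
Proof. by elim: k => [|k IH]; [rewrite /wpow/= cats0 | rewrite wpowS {1}IH catA]. Qed.

Lemma wpowD x k l : wpow x (k + l) = wpow x k ++ wpow x l.
Proof. by rewrite /wpow nseqD flatten_cat. Qed.

Lemma size_wpow x k : size (wpow x k) = (k * size x)%N.
Proof. by elim: k => // k IH; rewrite wpowS size_cat IH mulSn. Qed.

Lemma wpow_conj x y k : wpow (x ++ y) k ++ x = x ++ wpow (y ++ x) k.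
Proof. by elim: k => [|k IH]; [rewrite /= cats0 | rewrite !wpowS -!catA IH]. Qed.

Lemma prefix_catl2 x y z : prefix (x ++ y) (x ++ z) = prefix y z.
Proof. by rewrite prefix_catr// eqxx. Qed.

Lemma prefix_comparable x y z : prefix x z -> prefix y z ->
  (size x <= size y)%N -> prefix x y.
Proof.
rewrite !prefixE => /eqP xz /eqP yz xy.
by rewrite -yz take_takel// xz.
Qed.

Lemma suffix_comparable x y z : suffix x z -> suffix y z ->
  (size x <= size y)%N -> suffix x y.
Proof.
rewrite -!prefix_rev => xz yz xy.
by apply: (prefix_comparable xz yz); rewrite !size_rev.
Qed.

Lemma prefix_catE x y z : prefix x (y ++ z) ->
  prefix x y \/ exists2 t, x = y ++ t & prefix t z.
Proof.
move=> xyz; case: (leqP (size x) (size y)) => xy.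
  by left; apply: prefix_comparable xyz _ xy; exact: prefix_prefix.
right; have : prefix y x.
  by apply: prefix_comparable _ xyz (ltnW xy); exact: prefix_prefix.
by move=> /prefixP[t xE]; exists t => //; move: xyz; rewrite xE prefix_catl2.
Qed.

Lemma infix_catE x y z : infix x (y ++ z) ->
  [\/ infix x y, infix x z |
      exists u v, [/\ x = u ++ v, suffix u y & prefix v z]].
Proof.
elim: y => [|c y IH] in x *; first by move=> ?; apply: Or32.
rewrite cat_cons infix_consl => /orP[|/IH[xy|xz|[u [v [-> uy vz]]]]].
- rewrite -cat_cons => /prefix_catE[/prefixW xy|[t -> tz]].
    by apply: Or31.
  by apply: Or33; exists (c :: y), t; rewrite suffix_refl.
- by apply: Or31; rewrite infix_consl xy orbT.
- by apply: Or32.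
- apply: Or33; exists u, v; split => //.
  by apply: suffix_trans uy _; exact: suffix_cons.
Qed.

Lemma drop_flatten bs K i : (forall b, b \in bs -> (size b <= K)%N) ->
  exists r bs', [/\ drop i (flatten bs) = r ++ flatten bs', (size r <= K)%N &
    {subset bs' <= bs}].
Proof.
elim: bs i => [|b bs IH] i bsK /=.
  by exists [::], [::].
have bK : (size b <= K)%N by apply: bsK; rewrite mem_head.
have [|bi] := ltnP i (size b).
  move=> ib; exists (drop i b), bs; split.
  - by rewrite drop_cat ib.
  - by rewrite size_drop; lia.
  - by move=> c cbs; rewrite inE cbs orbT.
have [|r [bs' [rE rK bs'bs]]] := IH (i - size b)%N.
  by move=> c cbs; apply: bsK; rewrite inE cbs orbT.
exists r, bs'; split => //.
- by rewrite drop_cat ltnNge bi.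
- by move=> c /bs'bs cbs; rewrite inE cbs orbT.
Qed.

Lemma take_flatten bs K i : (forall b, b \in bs -> (size b <= K)%N) ->
  exists r bs', [/\ take i (flatten bs) = flatten bs' ++ r, (size r <= K)%N &
    {subset bs' <= bs}].
Proof.
elim: bs i => [|b bs IH] i bsK /=.
  by exists [::], [::].
have bK : (size b <= K)%N by apply: bsK; rewrite mem_head.
have [|bi] := ltnP i (size b).
  move=> ib; exists (take i b), [::]; split => //.
  - by rewrite take_cat ib.
  - by rewrite size_take ib; lia.
have [|r [bs' [rE rK bs'bs]]] := IH (i - size b)%N.
  by move=> c cbs; apply: bsK; rewrite inE cbs orbT.
exists r, (b :: bs'); split => //.
- by rewrite take_cat ltnNge bi /= rE catA.
- by move=> c; rewrite !inE => /orP[->//|/bs'bs ->]; rewrite orbT.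
Qed.

Lemma infix_flatten bs K x : (forall b, b \in bs -> (size b <= K)%N) ->
  infix x (flatten bs) ->
  exists r bs' r', [/\ x = r ++ flatten bs' ++ r', (size r <= K)%N,
    (size r' <= K)%N & {subset bs' <= bs}].
Proof.
move=> bsK /infixP[p [t E]].
have [r [bs1 [rE rK bs1bs]]] := drop_flatten (size p) bsK.
have xE : take (size x) (r ++ flatten bs1) = x.
  by rewrite -rE E drop_size_cat// take_size_cat.
have [xr|rx] := ltnP (size x) (size r).
  exists x, [::], [::]; split => //; first by rewrite /= cats0.
  by rewrite (leq_trans (ltnW xr)).
have [|r' [bs2 [r'E r'K bs2bs]]] := @take_flatten bs1 K (size x - size r).
  by move=> b /bs1bs; exact: bsK.
exists r, bs2, r'; split => //.
- by rewrite -r'E -{1}xE take_cat ltnNge rx.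
- by move=> b /bs2bs/bs1bs.
Qed.

End words.

(** * Subwords of two-sided sequences *)

Section subword.
Variable S : Type.
Implicit Types (w : int -> S).

Lemma size_subword w i k : size (subword w i k) = k.
Proof. exact: size_mkseq. Qed.

Lemma nth_subword x0 w i k m : (m < k)%N ->
  nth x0 (subword w i k) m = w (i + m%:Z).
Proof. by move=> mk; rewrite nth_mkseq. Qed.

Lemma subwordD w i k l :
  subword w i (k + l) = subword w i k ++ subword w (i + k%:Z) l.
Proof.
apply: (@eq_from_nth _ (w 0)) => [|m].
  by rewrite size_cat !size_subword.
rewrite size_subword => mkl; rewrite nth_cat size_subword nth_subword//.
case: ltnP => mk; first by rewrite nth_subword.
by rewrite nth_subword; [congr w; lia | lia].
Qed.

Lemma subword_shiftz w m i k : subword (shiftz m w) i k = subword w (i + m) k.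
Proof. by apply: eq_mkseq => j; rewrite /shiftz addrAC. Qed.

Lemma subword_inner w (i i' : int) (k k' : nat) : i <= i' -> i' + k'%:Z <= i + k%:Z ->
  exists p t, subword w i k = p ++ subword w i' k' ++ t.
Proof.
move=> ii' kk'; pose d := absz (i' - i)%R; pose e := absz (i + k%:Z - (i' + k'%:Z))%R.
exists (subword w i d), (subword w (i' + k'%:Z) e).
have -> : k = (d + (k' + e))%N by lia.
by rewrite !subwordD; congr (_ ++ subword _ _ _ ++ subword _ _ _); lia.
Qed.

End subword.

(** * Combinatorics of the words s_n *)

Section sturm.
Variables (R : realType) (alpha : R).
Hypotheses (alpha01 : 0 < alpha < 1) (alpha_irr : irrational alpha).
Local Notation s := (sturm_word alpha).
Local Notation a := (partial_quotient alpha).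

Lemma sturm_wordSS n : s n.+2 = wpow (s n.+1) (a n.+2) ++ s n.
Proof. by []. Qed.

Lemma sturm_wordSS_predn n :
  s n.+2 = s n.+1 ++ wpow (s n.+1) (a n.+2).-1 ++ s n.
Proof.
rewrite sturm_wordSS; have := partial_quotient_gt0 n.+1 alpha01 alpha_irr.
by case: (a n.+2) => // k _; rewrite wpowS catA.
Qed.

Lemma leq_size_sturm_word n : (n <= size (s n))%N.
Proof. by have [] := size_sturm_word alpha01 alpha_irr n. Qed.

Lemma size_sturm_wordSS n :
  size (s n.+2) = (a n.+2 * size (s n.+1) + size (s n))%N.
Proof. by rewrite sturm_wordSS size_cat size_wpow. Qed.

Lemma size_sturm_wordS n : (size (s n) <= size (s n.+1))%N.
Proof.
case: n => [|n]; first by rewrite /= size_cat addn1.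
rewrite [leqRHS]size_sturm_wordSS.
have := partial_quotient_gt0 n.+1 alpha01 alpha_irr; nia.
Qed.

Lemma size_sturm_word_homo : {homo (fun n => size (s n)) : m n / (m <= n)%N}.
Proof. exact: (homo_leq (@leqnn) (@leq_trans) size_sturm_wordS). Qed.

Lemma suffix_sturm_wordSS n : suffix (s n) (s n.+2).
Proof. by rewrite sturm_wordSS suffix_suffix. Qed.

Lemma prefix_sturm_wordS n : prefix (s n.+1) (s n.+2).
Proof. by rewrite sturm_wordSS_predn prefix_prefix. Qed.

(** After its first s_(n+2), the word s_(n+3) goes on with s_(n+1) or with a further s_(n+2), which
    itself begins with s_(n+1). The indices are shifted because s_0 need not be a prefix of s_1. *)
Lemma prefix_sturm_word_cat n : prefix (s n.+2 ++ s n.+1) (s n.+3).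
Proof.
rewrite (sturm_wordSS_predn n.+1) prefix_catl2.
case: (a n.+3).-1 => [|k] /=; first exact: prefix_refl.
rewrite wpowS -catA; apply: prefix_catl; exact: prefix_sturm_wordS.
Qed.

Lemma suffix_sturm_word_cat n : suffix (s n.+1 ++ s n) (s n.+2).
Proof.
rewrite sturm_wordSS; have := partial_quotient_gt0 n.+1 alpha01 alpha_irr.
by case: (a n.+2) => // k _; rewrite wpowSr -catA suffix_suffix.
Qed.

(** The square arises where s_(n+3) meets s_(n+2) inside s_(n+4): the former ends with s_(n+1), the
    latter begins with it. This puts windows around the origin of u and v into the language. *)
Lemma infix_sturm_word_sq n : infix (s n.+1 ++ s n.+1) (s n.+4).
Proof.
apply: infix_prefix_trans (prefix_sturm_word_cat _).
have /suffixP[p ->] := suffix_sturm_wordSS n.+1.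
have /prefixP[t ->] := prefix_sturm_wordS n.
by apply/infixP; exists p, t; rewrite !catA.
Qed.

(** s_(n+2) s_(n+1) and s_(n+1) s_(n+2) share the prefix s_(n+1)^a, after which s_n s_(n+1) and
    s_(n+1) s_n remain: each step lengthens [z] and swaps the two endings. *)
Lemma sturm_word_near_comm n : exists z e e', [/\ size e = 2%N, size e' = 2%N,
  s n.+1 ++ s n = z ++ e & s n ++ s n.+1 = z ++ e'].
Proof.
elim: n => [|n [z [e [e' [se se' E E']]]]].
  exists (wpow [:: false] (a 1).-1), [:: true; false], [:: false; true].
  split=> //; rewrite [s 1]/=; first by rewrite -catA.
  by rewrite catA -[s 0 ++ _](wpowS [:: false]) wpowSr -catA.
exists (wpow (s n.+1) (a n.+2) ++ z), e', e; split => //.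
- by rewrite sturm_wordSS -catA E' catA.
- by rewrite sturm_wordSS -catA -E !catA -wpowS -wpowSr.
Qed.


(** Iterates the recursion down to level n, so that growth bounds for only two words pass to the
    whole language. *)
Lemma sturm_word_flatten n k : exists2 bs, s (n + k) = flatten bs &
  {subset bs <= [:: s n; s n.+1]}.
Proof.
elim/ltn_ind: k => -[|[|k]] IH.
- by exists [:: s n]; rewrite /= ?cats0 ?addn0// => b; rewrite !inE => ->.
- exists [:: s n.+1]; rewrite /= ?cats0 ?addn1//.
  by move=> b; rewrite !inE => ->; rewrite orbT.
have [bs bsE bss] := IH k.+1 (leqnn _).
have [bs' bs'E bs's] := IH k (leqnSn _).
rewrite !addnS in bsE *; rewrite sturm_wordSS bsE bs'E.
have [bs2 -> bs2s] : exists2 bs2,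
    wpow (flatten bs) (a (n + k).+2) = flatten bs2 & {subset bs2 <= bs}.
  elim: (a _) => [|m [bs2 E bs2s]]; first by exists [::].
  exists (bs ++ bs2); first by rewrite wpowS E flatten_cat.
  by move=> b; rewrite mem_cat => /orP[//|/bs2s].
exists (bs2 ++ bs'); first by rewrite flatten_cat.
by move=> b; rewrite mem_cat => /orP[/bs2s/bss|/bs's].
Qed.

(** A factor of s_(n+1)^a s_n that crosses a boundary is cut at the first one it crosses: on the
    left stands a suffix of s_(n+1), on the right a prefix of s_(n+1)^k s_n. In condition (alpha)
    the cut becomes the origin of u or v. *)
Lemma infix_sturm_word_cut n (x : seq bool) : infix x (s n) -> exists l r j i,
  [/\ x = l ++ r, suffix l (s j) & prefix r (s i.+1)].
Proof.
have suf m y : suffix y (s m) -> exists l r j i,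
    [/\ y = l ++ r, suffix l (s j) & prefix r (s i.+1)].
  by exists y, [::], m, 0; split; rewrite ?cats0 ?prefix0s.
have pre m y : prefix y (s m.+1) -> exists l r j i,
    [/\ y = l ++ r, suffix l (s j) & prefix r (s i.+1)].
  by exists [::], y, 0, m; split; rewrite ?suffix0s.
elim/ltn_ind: n x => -[|[|n]] IH x.
- by rewrite infixs1 => /orP[]/eqP ->; apply: (suf 0).
(* A factor of s_1 = 0^(a_1 - 1) 1 is a suffix of it or a power of 0, hence a prefix. *)
- rewrite [s 1]/= cats1 infix_rconsl => /orP[|/infixP[p [t E]]].
    by rewrite -cats1; apply: (suf 1).
  apply: (pre 0); apply: prefix_catl.
  have /all_pred1P xE : all (pred1 false) x.
    suff : all (pred1 false) (p ++ x ++ t) by rewrite !all_cat => /and3P[].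
    by rewrite -E; elim: (_.-1).
  have kE : (size x <= (a 1).-1)%N.
    by move: (congr1 size E); rewrite size_wpow/= muln1 !size_cat; lia.
  have nE k : nseq k false = wpow [:: false] k by elim: k => //= k ->.
  by rewrite xE nE -(subnKC kE) wpowD prefix_prefix.
- rewrite sturm_wordSS => xs0.
  have [k xs ka] : exists2 k, infix x (wpow (s n.+1) k ++ s n) & (k <= a n.+2)%N.
    by exists (a n.+2).
  elim: k xs ka => [|k IHk] xs ka {xs0}; first by exact: (IH n _ _ xs).
  rewrite wpowS -catA in xs; case/infix_catE: xs.
  + exact: (IH n.+1).
  + by move=> xk; exact: IHk xk (ltnW ka).
  + move=> [l [r [xE ls rs]]].
    have preE z : prefix z (s n.+1) -> prefix (wpow (s n.+1) k ++ z) (s n.+2).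
      move=> zs; rewrite sturm_wordSS -(subnKC ka) wpowD wpowSr -!catA.
      by rewrite prefix_catl2; exact: prefix_catl.
    have cut_r : prefix r (s n.+2) -> exists l r j i,
        [/\ x = l ++ r, suffix l (s j) & prefix r (s i.+1)].
      by exists l, r, n.+1, n.+1.
    case/prefix_catE: rs => [rs|[t rE ts]].
      by apply: cut_r; apply: (prefix_trans rs); rewrite -[wpow _ _]cats0 preE ?prefix0s.
    (* For n > 0, s_n is a prefix of s_(n+1), so s_(n+1)^k t with k < a is still a prefix of
       s_(n+2). *)
    case: n => [|n] in ls ts IH IHk cut_r preE ka xE rE *; last first.
      by apply: cut_r; rewrite rE preE// (prefix_trans ts)// prefix_sturm_wordS.
    move: ts; rewrite [s 0]/= prefixs1 => /orP[]/eqP tE.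
      by apply: cut_r; rewrite rE tE preE ?prefix0s.
    (* For n = 0 the letter s_0 may fail to begin s_1, but here x reaches the end of s_2 and is a
       suffix of it as a whole. *)
    apply: (suf 2); rewrite sturm_wordSS -(subnK ka) wpowD xE rE tE -[s 0]/[:: false].
    rewrite wpowS; case/suffixP: ls => p ->.
    by rewrite -!catA !(catA _ p) suffix_suffix.
Qed.

(** Rounding the length of x up to a multiple of |s_(n+1)| adds at most |s_(n+1)| letters; beyond
    the last full power at most |s_n| letters are missing. Both are at most |x|. *)
Lemma prefix_sturm_word_extend n (x : seq bool) :
  prefix x (s n.+2) -> (size (s n.+1) <= size x)%N ->
  exists2 y, (size y <= size x)%N & x ++ y = s n.+2 \/
    exists2 b, (0 < b <= a n.+2)%N & x ++ y = wpow (s n.+1) b.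
Proof.
move=> xs qx; have q0 := leq_size_sturm_word n.+1.
have [xa|ax] := ltnP (size x) (a n.+2 * size (s n.+1)); last first.
  have [y E] : exists y : seq bool, s n.+2 = x ++ y by exact/prefixP.
  exists y; last by left.
  have : (size x + size y = a n.+2 * size (s n.+1) + size (s n))%N.
    by rewrite -size_sturm_wordSS E size_cat.
  by have := size_sturm_wordS n; lia.
set b := (size x %/ size (s n.+1)).+1.
have q00 : (0 < size (s n.+1))%N by lia.
have ba : (b <= a n.+2)%N by rewrite ltn_divLR.
have xb : (size x <= b * size (s n.+1))%N by rewrite ltnW// ltn_ceil.
have [y E] : exists y : seq bool, wpow (s n.+1) b = x ++ y.
  apply/prefixP.
  apply: (prefix_comparable xs); last by rewrite size_wpow.
  by rewrite sturm_wordSS -(subnKC ba) wpowD -catA prefix_prefix.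
exists y; last by right; exists b.
have : (size x + size y = b * size (s n.+1))%N.
  by rewrite -size_cat -E size_wpow.
have := leq_trunc_div (size x) (size (s n.+1)).
by rewrite /b mulSn; set dQ := (_ %/ _ * _)%N; lia.
Qed.

(** Mirror image of [prefix_sturm_word_extend]: read from the right, s_(n+3) = s_(n+1) (t s_(n+1))^a
    shows powers of the rotation t s_(n+1) of s_(n+2). *)
Lemma suffix_sturm_word_extend n (t x : seq bool) : s n.+2 = s n.+1 ++ t ->
  suffix x (s n.+3) -> (size (s n.+2) <= size x)%N ->
  exists2 y, (size y <= size x)%N & y ++ x = s n.+3 \/
    exists2 b, (0 < b <= a n.+3)%N & y ++ x = wpow (t ++ s n.+1) b.
Proof.
move=> tE xs qx; have q0 := leq_size_sturm_word n.+2.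
have sE : s n.+3 = s n.+1 ++ wpow (t ++ s n.+1) (a n.+3).
  by rewrite sturm_wordSS tE wpow_conj.
have tq : size (t ++ s n.+1) = size (s n.+2).
  by rewrite tE !size_cat addnC.
have [xa|ax] := ltnP (size x) (a n.+3 * size (s n.+2)); last first.
  have [y E] : exists y : seq bool, s n.+3 = y ++ x by exact/suffixP.
  exists y; last by left.
  have : (size x + size y = a n.+3 * size (s n.+2) + size (s n.+1))%N.
    by rewrite -size_sturm_wordSS E size_cat addnC.
  by have := size_sturm_wordS n.+1; lia.
set b := (size x %/ size (s n.+2)).+1.
have q00 : (0 < size (s n.+2))%N by lia.
have ba : (b <= a n.+3)%N by rewrite ltn_divLR.
have xb : (size x <= b * size (s n.+2))%N by rewrite ltnW// ltn_ceil.
have [y E] : exists y : seq bool, wpow (t ++ s n.+1) b = y ++ x.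
  apply/suffixP.
  apply: (suffix_comparable xs); last by rewrite size_wpow tq.
  by rewrite sE -(subnK ba) wpowD catA suffix_suffix.
exists y; last by right; exists b.
have : (size x + size y = b * size (s n.+2))%N.
  by rewrite addnC -size_cat -E size_wpow tq.
have := leq_trunc_div (size x) (size (s n.+2)).
by rewrite /b mulSn; set dQ := (_ %/ _ * _)%N; lia.
Qed.

End sturm.

(** ** The entrywise norm of matrices *)

Section mxsum.
Variable R : realType.

(** The entrywise l^1 norm. It is submultiplicative, comparable to the operator norm, and exactly
    invariant under inversion on SL(2,R). *)
Definition mxsum (m n : nat) (M : 'M[R]_(m, n)) : R := \sum_i \sum_j `|M i j|.

Lemma mxsum_ge0 m n (M : 'M[R]_(m, n)) : 0 <= mxsum M.
Proof. by apply: sumr_ge0 => i _; exact: sumr_ge0. Qed.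

Lemma le_mxsum m n (M : 'M[R]_(m, n)) i j : `|M i j| <= mxsum M.
Proof.
rewrite /mxsum (bigD1 i)//= (bigD1 j)//= -addrA lerDl addr_ge0//.
  by apply: sumr_ge0.
by apply: sumr_ge0 => k _; exact: sumr_ge0.
Qed.

Lemma mxsumD m n (M N : 'M[R]_(m, n)) : mxsum (M + N) <= mxsum M + mxsum N.
Proof.
rewrite /mxsum -big_split; apply: ler_sum => i _; rewrite -big_split.
by apply: ler_sum => j _; rewrite mxE ler_normD.
Qed.

Lemma mxsumZ m n (t : R) (M : 'M[R]_(m, n)) : mxsum (t *: M) = `|t| * mxsum M.
Proof.
rewrite /mxsum mulr_sumr; apply: eq_bigr => i _; rewrite mulr_sumr.
by apply: eq_bigr => j _; rewrite mxE normrM.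
Qed.

Lemma mxsumN m n (M : 'M[R]_(m, n)) : mxsum (- M) = mxsum M.
Proof. by rewrite -scaleN1r mxsumZ normrN1 mul1r. Qed.

Lemma mxsumM m n p (M : 'M[R]_(m, n)) (N : 'M[R]_(n, p)) :
  mxsum (M *m N) <= mxsum M * mxsum N.
Proof.
rewrite {1 2}/mxsum mulr_suml; apply: ler_sum => i _.
apply: (@le_trans _ _ (\sum_j \sum_k `|M i k| * `|N k j|)).
  apply: ler_sum => j _; rewrite mxE; apply: le_trans (ler_norm_sum _ _ _) _.
  by apply: ler_sum => k _; rewrite normrM.
rewrite exchange_big mulr_suml; apply: ler_sum => k _ /=.
rewrite -mulr_sumr ler_wpM2l// /mxsum (bigD1 k)//= lerDl.
by apply: sumr_ge0 => l _; exact: sumr_ge0.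
Qed.

Lemma mxsum_eq0 m n (M : 'M[R]_(m, n)) : (mxsum M == 0) = (M == 0).
Proof.
apply/idP/eqP => [/eqP M0|->]; last first.
  by rewrite /mxsum big1// => i _; rewrite big1// => j _; rewrite mxE normr0.
apply/matrixP => i j; rewrite mxE; apply/eqP; rewrite -normr_le0 -M0.
exact: le_mxsum.
Qed.

Lemma sum2 (F : 'I_2 -> R) : \sum_i F i = F 0 + F 1.
Proof. by rewrite big_ord_recl big_ord1; congr (_ + F _); apply/val_inj. Qed.

Lemma matrix2P (M N : 'M[R]_2) : M 0 0 = N 0 0 -> M 0 1 = N 0 1 ->
  M 1 0 = N 1 0 -> M 1 1 = N 1 1 -> M = N.
Proof.
move=> h00 h01 h10 h11; apply/matrixP => i j.
have ord2 (k : 'I_2) : k = 0 \/ k = 1.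
  by case: k => -[|[|//]] ?; [left|right]; apply/val_inj.
by case: (ord2 i) => ->; case: (ord2 j) => ->.
Qed.

Lemma det2 (M : 'M[R]_2) : \det M = M 0 0 * M 1 1 - M 0 1 * M 1 0.
Proof.
rewrite (expand_det_row _ 0) sum2 /cofactor !det_mx11 !mxE /=.
have -> : lift 0 0 = 1 :> 'I_2 by apply/val_inj.
have -> : lift 1 0 = 0 :> 'I_2 by apply/val_inj.
by rewrite expr0 expr1; ring.
Qed.

Lemma mxtrace2 (M : 'M[R]_2) : \tr M = M 0 0 + M 1 1.
Proof. exact: sum2. Qed.

Lemma mxsum2 (M : 'M[R]_2) :
  mxsum M = `|M 0 0| + `|M 0 1| + (`|M 1 0| + `|M 1 1|).
Proof. by rewrite /mxsum !sum2. Qed.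

(** Cayley-Hamilton. *)
Lemma sqr_mx2 (M : 'M[R]_2) : M *m M = \tr M *: M - (\det M)%:M.
Proof. by apply: matrix2P; rewrite !(mxE, sum2) mxtrace2 det2 /=; ring. Qed.

Lemma invmx_det1 (M : 'M[R]_2) : \det M = 1 -> invmx M = (\tr M)%:M - M.
Proof.
move=> M1; have Mu : M \in unitmx by rewrite unitmxE M1 unitr1.
rewrite -[RHS](mulKmx Mu) mulmxBr sqr_mx2 M1 mul_mx_scalar.
by rewrite opprB addrCA subrr addr0 mulmx1.
Qed.

(** The inverse is the adjugate, which has the same entries up to order and sign. *)
Lemma mxsum_invmx (M : 'M[R]_2) : \det M = 1 -> mxsum (invmx M) = mxsum M.
Proof.
move=> M1; rewrite invmx_det1// !mxsum2 mxtrace2 !mxE /=.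
rewrite !mulr1n !mulr0n !sub0r !normrN addrK.
have -> : M 0 0 + M 1 1 - M 0 0 = M 1 1 by ring.
ring.
Qed.

(** With x, y, z, w the absolute values of the entries, 1 <= x w + y z <= ((x + w)^2 + (y + z)^2) /
    4, which is at most a quarter of the squared norm. Hence all logarithms of norms below are
    nonnegative. *)
Lemma mxsum_ge2 (M : 'M[R]_2) : \det M = 1 -> 2 <= mxsum M.
Proof.
move=> M1; have := congr1 Num.norm M1; rewrite normr1 det2.
move: (ler_normB (M 0 0 * M 1 1) (M 0 1 * M 1 0)); rewrite !normrM mxsum2.
move: (normr_ge0 (M 0 0)) (normr_ge0 (M 0 1)) (normr_ge0 (M 1 0))
  (normr_ge0 (M 1 1)).
move: `|M 0 0| `|M 0 1| `|M 1 0| `|M 1 1| => x y z w x0 y0 z0 w0 h1 h2.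
rewrite leNgt; apply/negP => h3.
have := sqr_ge0 (x - w); have := sqr_ge0 (y - z); rewrite !expr2; nra.
Qed.

Lemma mxtrace_le_mxsum (M : 'M[R]_2) : `|\tr M| <= mxsum M.
Proof.
rewrite mxtrace2 mxsum2; have := ler_normD (M 0 0) (M 1 1).
have := normr_ge0 (M 0 1); have := normr_ge0 (M 1 0); lra.
Qed.

Lemma le_vnorm2 n (v : 'cV[R]_n) i : `|v i 0| <= vnorm2 v.
Proof.
rewrite -sqrtr_sqr ler_wsqrtr// (bigD1 i)//= lerDl.
by apply: sumr_ge0 => j _; exact: sqr_ge0.
Qed.

Lemma mxsum_cV n (v : 'cV[R]_n) : mxsum v = \sum_i `|v i 0|.
Proof. by apply: eq_bigr => i _; rewrite big_ord1. Qed.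

Lemma vnorm2_le_mxsum n (v : 'cV[R]_n) : vnorm2 v <= mxsum v.
Proof.
rewrite -[leRHS]ger0_norm ?mxsum_ge0// -sqrtr_sqr ler_wsqrtr//.
rewrite expr2 mxsum_cV mulr_suml; apply: ler_sum => i _.
rewrite -real_normK ?num_real// expr2 ler_wpM2l//.
by rewrite (bigD1 i)//= lerDl; exact: sumr_ge0.
Qed.

Lemma mxsum_le_vnorm2 n (v : 'cV[R]_n) : mxsum v <= n%:R * vnorm2 v.
Proof.
rewrite mxsum_cV; apply: (@le_trans _ _ (\sum_(i < n) vnorm2 v)).
  by apply: ler_sum => i _; exact: le_vnorm2.
by rewrite sumr_const card_ord mulr_natl.
Qed.

Lemma has_sup_opnorm2 n (M : 'M[R]_n) :
  has_sup [set vnorm2 (M *m v) | v in [set v : 'cV[R]_n | vnorm2 v <= 1]].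
Proof.
split.
  exists (vnorm2 (M *m 0)), 0 => //=; apply: le_trans (vnorm2_le_mxsum _) _.
  by have /eqP -> : mxsum (0 : 'cV[R]_n) == 0 by rewrite mxsum_eq0.
exists (mxsum M * n%:R) => _ [v /= v1 <-].
apply: le_trans (vnorm2_le_mxsum _) _; apply: le_trans (mxsumM _ _) _.
rewrite ler_wpM2l ?mxsum_ge0//; apply: le_trans (mxsum_le_vnorm2 _) _.
by rewrite ler_piMr.
Qed.

Lemma opnorm2_le_mxsum n (M : 'M[R]_n) : opnorm2 M <= mxsum M * n%:R.
Proof.
have [h _] := has_sup_opnorm2 M; apply: ge_sup => // _ [v /= v1 <-].
apply: le_trans (vnorm2_le_mxsum _) _; apply: le_trans (mxsumM _ _) _.
rewrite ler_wpM2l ?mxsum_ge0//; apply: le_trans (mxsum_le_vnorm2 _) _.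
by rewrite ler_piMr.
Qed.

Lemma le_opnorm2 n (M : 'M[R]_n) i j : `|M i j| <= opnorm2 M.
Proof.
apply: (@le_trans _ _ (vnorm2 (M *m delta_mx j 0))).
  by have := le_vnorm2 (M *m delta_mx j 0) i; rewrite -colE mxE.
apply: ub_le_sup; first by case: (has_sup_opnorm2 M).
exists (delta_mx j 0) => //=; apply: le_trans (vnorm2_le_mxsum _) _.
rewrite mxsum_cV (bigD1 j)//= mxE !eqxx normr1 big1 ?addr0// => k /negPf kj.
by rewrite mxE kj normr0.
Qed.

Lemma mxsum_le_opnorm2 (M : 'M[R]_2) : mxsum M <= 4 * opnorm2 M.
Proof.
rewrite mxsum2; have h := le_opnorm2 M.
by have := h 0 0; have := h 0 1; have := h 1 0; have := h 1 1; lra.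
Qed.

(** Up to a constant, which disappears after division by n, the growth conditions can be checked for
    [mxsum]. *)
Lemma ln_opnorm2 (M : 'M[R]_2) : \det M = 1 ->
  `|ln (opnorm2 M) - ln (mxsum M)| <= ln 4.
Proof.
move=> M1; have m2 := mxsum_ge2 M1.
have o0 : 0 < opnorm2 M by have := mxsum_le_opnorm2 M; lra.
have h1 : ln (opnorm2 M) <= ln (mxsum M) + ln 2.
  by rewrite -lnM ?posrE; [rewrite ler_ln ?posrE ?opnorm2_le_mxsum//; lra|lra|lra].
have h2 : ln (mxsum M) <= ln 4 + ln (opnorm2 M).
  by rewrite -lnM ?posrE; [rewrite ler_ln ?posrE ?mxsum_le_opnorm2//; lra|lra|lra].
have h3 : ln 2 <= ln 4 :> R by rewrite ler_ln ?posrE//; lra.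
by rewrite ler_norml; lra.
Qed.

End mxsum.

(** ** Powers of matrices of determinant one *)

Section SL2_powers.
Variables (R : realType) (M : 'M[R]_2).
Hypothesis detM : \det M = 1.
Local Notation t := (\tr M).

Lemma det_exp k : \det (M ^+ k) = 1.
Proof.
elim: k => [|k IH]; first by rewrite expr0 det1.
by rewrite exprS -[_ * _]/(_ *m _) det_mulmx detM IH mulr1.
Qed.

Lemma expmxSS k : M ^+ k.+2 = t *: M ^+ k.+1 - M ^+ k.
Proof.
rewrite !exprS mulrA -[M * M]/(M *m M) sqr_mx2 detM mulrBl.
by rewrite -scalerAl (_ : 1%:M = 1)// mul1r.
Qed.

Lemma mxsum_exp_le k : mxsum (M ^+ k.+1) <= (`|t| + 1) ^+ k * mxsum M.
Proof.
elim/ltn_ind: k => -[|[|k]] IH.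
- by rewrite expr1 expr0 mul1r.
(* M^2 = t M - 1, and the identity has norm 2, at most that of M. *)
- rewrite expmxSS !expr1 expr0; apply: le_trans (mxsumD _ _) _.
  rewrite mxsumN mxsumZ mulrDl lerD2l mul1r.
  rewrite mxsum2 !mxE /= mulr1n mulr0n normr1 normr0.
  by have := mxsum_ge2 detM; lra.
- rewrite expmxSS; apply: le_trans (mxsumD _ _) _.
  rewrite mxsumN mxsumZ [(_ + 1) ^+ _]exprS mulrDl mul1r mulrDl -!mulrA lerD//.
    by rewrite ler_wpM2l// IH.
  apply: le_trans (IH k _) _ => //; rewrite ler_wpM2r ?mxsum_ge0//.
  by rewrite exprS ler_peMl ?exprn_ge0 ?addr_ge0// lerDr.
Qed.

(** The traces obey the recurrence of the powers. As long as their absolute values do not decrease,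
    the next one gains a factor |t| - 1 >= 1, so they never do; the start is |t^2 - 2| >= (|t| - 1)
    |t|. *)
Lemma mxtrace_exp_ge k : 2 <= `|t| -> (`|t| - 1) ^+ k <= `|\tr (M ^+ k)|.
Proof.
move=> t2; have tE j : \tr (M ^+ j.+2) = t * \tr (M ^+ j.+1) - \tr (M ^+ j).
  by rewrite expmxSS mxtraceD mxtraceZ raddfN.
have h j : (`|t| - 1) * `|\tr (M ^+ j.+1)| <= `|\tr (M ^+ j.+2)|.
  elim: j => [|j IH]; rewrite [in leRHS]tE; apply: le_trans _ (lerB_dist _ _); rewrite normrM.
    rewrite expr0 expr1 mxtrace1 normr_nat; nra.
  have : `|\tr (M ^+ j.+1)| <= `|\tr (M ^+ j.+2)|.
    by apply: le_trans _ IH; rewrite ler_peMl//; lra.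
  by rewrite mulrBl mul1r; lra.
case: k => [|k]; first by rewrite !expr0 mxtrace1 normr_nat; lra.
elim: k => [|k IH]; first by rewrite !expr1; lra.
apply: le_trans _ (h k); rewrite exprS ler_wpM2l//; lra.
Qed.

Lemma ln_mxsum_exp_le k :
  ln (mxsum (M ^+ k.+1)) <= k%:R * ln (`|t| + 1) + ln (mxsum M).
Proof.
have m0 : 0 < mxsum M by have := mxsum_ge2 detM; lra.
have t0 : 0 < `|t| + 1 by have := normr_ge0 t; lra.
rewrite mulr_natl -lnXn// -lnM ?posrE ?exprn_gt0// ler_ln ?posrE.
- exact: mxsum_exp_le.
- by have := mxsum_ge2 (det_exp k.+1); lra.
- by rewrite mulr_gt0 ?exprn_gt0.
Qed.

Lemma ln_mxsum_exp_ge k : 2 <= `|t| ->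
  k%:R * ln (`|t| - 1) <= ln (mxsum (M ^+ k)).
Proof.
move=> t2; have t0 : 0 < `|t| - 1 by lra.
rewrite mulr_natl -lnXn// ler_ln ?posrE ?exprn_gt0//.
  by apply: le_trans (mxtrace_exp_ge _ t2) (mxtrace_le_mxsum _).
by have := mxsum_ge2 (det_exp k); lra.
Qed.

(* Gordon's argument: by Cayley-Hamilton, [M v + M^-1 v = t v] and
   [M^2 v + v = t M v]; use the former if [|t| >= 1], else the latter. *)
Lemma gordon (v : 'cV[R]_2) : mxsum v <=
  mxsum (invmx M *m v) + mxsum (M *m v) + mxsum (M *m (M *m v)).
Proof.
have [t1|t1] := lerP 1 `|t|.
  have : mxsum (t *: v) <= mxsum (invmx M *m v) + mxsum (M *m v).
    rewrite -[_ *: _](_ : invmx M *m v + M *m v = _) ?mxsumD//.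
    by rewrite -mulmxDl invmx_det1// subrK mul_scalar_mx.
  rewrite mxsumZ; have := mxsum_ge0 (M *m (M *m v)).
  have := mxsum_ge0 v; nra.
have : mxsum v <= mxsum (t *: (M *m v)) + mxsum (M *m (M *m v)).
  rewrite -[mxsum (M *m _)]mxsumN.
  rewrite -[in leLHS](_ : t *: (M *m v) - M *m (M *m v) = v) ?mxsumD//.
  by rewrite mulmxA sqr_mx2 detM mulmxBl scalemxAl mul1mx opprB addrC subrK.
rewrite mxsumZ; have := mxsum_ge0 (invmx M *m v).
have := mxsum_ge0 (M *m v); have := normr_ge0 t; nra.
Qed.

End SL2_powers.

(** * Ratios along a subadditive recursion *)

(** The ratio [x n.+2] is at most a weighted mean of the two previous ones, so the maximum [y n] of
    two consecutive ratios decreases; l is its infimum. *)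
Lemma subadditive_ratio_cvg (R : realType) (a : nat -> nat) (q f : nat -> R) :
  (forall n, (0 < a n)%N) -> (forall n, 0 < q n) ->
  (forall n, q n <= q n.+1) -> (forall n, q n.+2 = (a n)%:R * q n.+1 + q n) ->
  (forall n, 0 <= f n) -> (forall n, f n.+2 <= (a n)%:R * f n.+1 + f n) ->
  exists2 l, 0 <= l & forall e, 0 < e ->
    exists n0, forall n, (n0 <= n)%N -> (l - e) * q n <= f n <= (l + e) * q n.
Proof.
move=> a0 q0 qS qE f0 fE; pose x n := f n / q n.
pose y n := Num.max (x n) (x n.+1).
have fx n : f n = x n * q n by rewrite /x divfK// gt_eqF.
have yx n : (x n <= y n) /\ (x n.+1 <= y n) by rewrite !le_max !lexx orbT.
have yS n : y n.+1 <= y n.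
  rewrite ge_max (yx n).2/= /x ler_pdivrMr// qE mulrDr.
  apply: (le_trans (fE n)); rewrite !fx.
  have [h1 h2] := yx n; have an : 0 <= (a n)%:R :> R by [].
  have h3 := ler_wpM2r (ltW (q0 n)) h1.
  have h4 := ler_wpM2l an (ler_wpM2r (ltW (q0 n.+1)) h2).
  by rewrite [y n * (_ * _)]mulrCA; lra.
have ym m n : (m <= n)%N -> y n <= y m.
  by elim: n => [|n IH]; [rewrite leqn0 => /eqP -> |
    rewrite leq_eqVlt => /predU1P[->//|/IH]; exact: le_trans].
have y0 n : 0 <= y n by apply: le_trans (yx n).1; rewrite divr_ge0// ltW.
have hi : has_inf (range y).
  by split; [exists (y 0), 0|exists 0 => _ [n _ <-]].
pose l := inf (range y).
have ly n : l <= y n by apply: ge_inf; [case: hi|exists n].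
exists l; first by apply: lb_le_inf => [|_ [n _ <-]//]; case: hi.
move=> e e0; have [_ [n0 _ <-] yn0] := inf_adherent e0 hi.
have up n : (n0 <= n)%N -> f n <= (l + e) * q n.
  move=> n0n; rewrite fx ler_wpM2r// ?(ltW (q0 _))//.
  by apply: (le_trans (yx n).1); apply: (le_trans (ym _ _ n0n)); exact: ltW.
exists n0.+1 => -[//|n] n0n; rewrite up ?andbT ?(leq_trans _ n0n)//.
rewrite leNgt; apply/negP => fl.
(* A ratio below l - e at n + 1 outweighs one of at most l + e at n, because a >= 1 and q is
   nondecreasing; then both ratios in [y n.+1] lie below l. *)
have fl2 : f n.+2 < l * q n.+2.
  apply: (le_lt_trans (fE n)); rewrite qE.
  have an : 1 <= (a n)%:R :> R by rewrite ler1n.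
  have h1 := up n n0n; have h2 := qS n; have h3 := q0 n.+1.
  have h4 : (a n)%:R * f n.+1 < (a n)%:R * ((l - e) * q n.+1).
    by rewrite ltr_pM2l// (lt_le_trans ltr01).
  have h5 : e * q n <= (a n)%:R * (e * q n.+1).
    by rewrite -[leLHS]mul1r ler_pM ?mulr_ge0 ?ler_pM2l// ltW.
  by nra.
have := ly n.+1; rewrite leNgt gt_max => /negP; apply; apply/andP; split.
  rewrite /x ltr_pdivrMr//; apply: (lt_le_trans fl).
  by rewrite ler_wpM2r ?(ltW (q0 _))//; lra.
by rewrite /x ltr_pdivrMr.
Qed.

(** ** Products along words *)

Section word_product.
Variables (R : realType) (T : eqType) (L : nat) (g : seq T -> 'M[R]_2) (D : R).
Hypothesis detg : forall w, \det (g w) = 1.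
Hypothesis D1 : 1 <= D.
Hypothesis gD : forall w, size w = L.+1 -> mxsum (g w) <= D.
Implicit Types (x y z w : seq T).

(** One factor for each window of L + 1 consecutive letters, later windows to the left as in the
    cocycle. Words of at most L letters contain no window. *)
Fixpoint wprod w : 'M[R]_2 :=
  if w is _ :: w' then
    if (L < size w)%N then wprod w' *m g (take L.+1 w) else 1%:M
  else 1%:M.

Lemma wprod_small w : (size w <= L)%N -> wprod w = 1%:M.
Proof. by case: w => [|c w]//= wL; rewrite ltnNge wL. Qed.

Lemma det_wprod w : \det (wprod w) = 1.
Proof.
elim: w => [|c w IH] /=; first by rewrite det1.
by case: ifP => _; rewrite ?det1// det_mulmx IH detg mulr1.
Qed.

(** A window that starts in x reaches at most L letters into y. *)
Lemma wprod_cat x y : (L <= size y)%N ->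
  wprod (x ++ y) = wprod y *m wprod (x ++ take L y).
Proof.
move=> Ly; have tL : size (take L y) = L by rewrite size_takel.
elim: x => [|c x IH]; first by rewrite /= (wprod_small (eq_leq tL)) mulmx1.
rewrite /= !size_cat tL !ltnS leq_addl (leq_trans Ly) ?leq_addl//.
rewrite IH -mulmxA; congr (_ *m (_ *m g (_ :: _))).
rewrite !take_cat; case: ifP => // Lx.
by rewrite take_takel// leq_subr.
Qed.

Lemma mxsum1 : mxsum (1%:M : 'M[R]_2) = 2.
Proof. by rewrite mxsum2 !mxE /= mulr1n mulr0n normr1 normr0; ring. Qed.

Lemma mxsum_wprod w : mxsum (wprod w) <= 2 * D ^+ size w.
Proof.
have le2 k : 2 <= 2 * D ^+ k by rewrite ler_peMr// exprn_ege1.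
elim: w => [|c w IH]; first by rewrite /= mxsum1 le2.
rewrite [wprod _]/=; case: ifP => Lw; last by rewrite mxsum1 le2.
apply: (le_trans (mxsumM _ _)); rewrite [size _]/= exprSr mulrA.
rewrite ler_pM ?mxsum_ge0// gD//; exact: (@size_takel L.+1 _ (c :: w)) Lw.
Qed.

Lemma wprod_catr x z : exists2 B, wprod (x ++ z) = B *m wprod x &
  \det B = 1 /\ mxsum B <= 2 * D ^+ (L + size z).
Proof.
elim: x => [|c x [B E HB]].
  exists (wprod z); first by rewrite /= mulmx1.
  split; first exact: det_wprod.
  by apply: (le_trans (mxsum_wprod _)); rewrite ler_wpM2l// ler_weXn2l// leq_addl.
have [Lx|xL] := ltnP L (size (c :: x)).
  exists B => //; rewrite /= in Lx *; rewrite size_cat Lx ltnS.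
  by rewrite (leq_trans _ (leq_addr _ _))// E mulmxA takel_cat.
(* x contains no window, so B is the whole product, over at most L + |z| letters. *)
exists (wprod ((c :: x) ++ z)); first by rewrite (wprod_small xL) mulmx1.
split; first exact: det_wprod.
apply: (le_trans (mxsum_wprod _)); rewrite ler_wpM2l// ler_weXn2l//.
by rewrite size_cat leq_add2r.
Qed.

(** B collects the windows across the cut, whose number is bounded independently of x and y. A y
    shorter than L has no windows of its own and is absorbed into B. *)
Lemma wprod_cat3 x y : exists2 B, wprod (x ++ y) = wprod y *m B *m wprod x &
  \det B = 1 /\ mxsum B <= 2 * D ^+ (L + L).
Proof.
have [Ly|yL] := leqP L (size y).
  have [B E [B1 BD]] := wprod_catr x (take L y).
  exists B; first by rewrite wprod_cat// E mulmxA.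
  by split => //; rewrite size_takel in BD.
have [B E [B1 BD]] := wprod_catr x y.
exists B; first by rewrite (wprod_small (ltnW yL)) mul1mx.
split=> //; apply: (le_trans BD); rewrite ler_wpM2l// ler_weXn2l//.
by rewrite leq_add2l ltnW.
Qed.

(** The first L letters of y complete the windows that start in the last period; every period then
    contributes the same factor, and the theory of matrix powers applies. *)
Lemma wprod_periodic y k : (L <= size y)%N ->
  wprod (wpow y k ++ take L y) = wprod (y ++ take L y) ^+ k.
Proof.
move=> Ly; elim: k => [|k IH].
  by rewrite expr0 wprod_small// size_take_min geq_minl.
rewrite wpowS -catA wprod_cat; last by rewrite size_cat size_takel// leq_addl.
rewrite IH exprSr; congr (_ *m wprod (_ ++ _)).
by case: k {IH} => [|k]; rewrite ?take_takel// wpowS -catA takel_cat.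
Qed.

(** Both products split into the same two factors, in opposite orders, and the trace is cyclic. *)
Lemma mxtrace_wprod_rot y z : (L <= size y)%N ->
  \tr (wprod ((y ++ z) ++ take L (y ++ z))) =
  \tr (wprod ((z ++ y) ++ take L (z ++ y))).
Proof.
move=> Ly; have tL : size (take L y) = L by rewrite size_takel.
have tE : take L (z ++ take L y) = take L (z ++ y).
  by rewrite !take_cat; case: ifP => // _; rewrite take_takel// leq_subr.
rewrite takel_cat// -catA wprod_cat; last by rewrite size_cat tL leq_addl.
rewrite mxtrace_mulC -catA [X in _ = \tr X]wprod_cat; last first.
  by rewrite size_cat (leq_trans Ly)// leq_addr.
by rewrite tE [in RHS](_ : take L (y ++ _) = take L y)// takel_cat.
Qed.

Definition lnprod w : R := ln (mxsum (wprod w)).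
Local Notation F := lnprod.

(** The logarithm of the bound on B in [wprod_cat3]. *)
Definition lnprod_defect : R := ln (2 * D ^+ (L + L)).
Local Notation C := lnprod_defect.

Lemma mxsum_wprod_gt0 w : 0 < mxsum (wprod w).
Proof. by have := mxsum_ge2 (det_wprod w); lra. Qed.

Lemma lnprod_ge0 w : 0 <= F w.
Proof. by apply: ln_ge0; have := mxsum_ge2 (det_wprod w); lra. Qed.

Let D_gt0 : 0 < D. Proof. exact: lt_le_trans D1. Qed.

Lemma lnprod_defect_ge0 : 0 <= C.
Proof. by apply: ln_ge0; have := exprn_ege1 (L + L) D1; lra. Qed.

Lemma lnprod_small w : (size w <= L)%N -> F w = ln 2.
Proof. by move=> wL; rewrite /F wprod_small// mxsum1. Qed.

Lemma lnprod_le w : F w <= ln 2 + (size w)%:R * ln D.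
Proof.
rewrite mulr_natl -lnXn // -lnM ?posrE ?exprn_gt0 //.
rewrite ler_ln ?posrE ?mxsum_wprod_gt0 ?mulr_gt0 ?exprn_gt0 //.
exact: mxsum_wprod.
Qed.

Lemma ln_mxsumM (M N : 'M[R]_2) : \det M = 1 -> \det N = 1 ->
  ln (mxsum (M *m N)) <= ln (mxsum M) + ln (mxsum N).
Proof.
move=> M1 N1; have m0 := mxsum_ge2 M1; have n0 := mxsum_ge2 N1.
have mn : \det (M *m N) = 1 by rewrite det_mulmx M1 N1 mulr1.
have mn0 := mxsum_ge2 mn.
rewrite -lnM ?posrE; [|lra|lra].
by rewrite ler_ln ?posrE ?mxsumM//; [lra|rewrite mulr_gt0//; lra].
Qed.

Lemma ln_mxsum_invmx (M : 'M[R]_2) : \det M = 1 ->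
  \det (invmx M) = 1 /\ ln (mxsum (invmx M)) = ln (mxsum M).
Proof. by move=> M1; rewrite det_inv M1 invr1 mxsum_invmx. Qed.

Let ln_defect (B : 'M[R]_2) : \det B = 1 -> mxsum B <= 2 * D ^+ (L + L) ->
  ln (mxsum B) <= C.
Proof.
move=> B1 BD; rewrite ler_ln ?posrE//.
  by have := mxsum_ge2 B1; lra.
by rewrite mulr_gt0 ?exprn_gt0.
Qed.

Lemma lnprod_cat x y : F (x ++ y) <= F x + F y + C.
Proof.
have [B E [B1 /(ln_defect B1) BD]] := wprod_cat3 x y.
have hy := det_wprod y; have hx := det_wprod x.
have hyB : \det (wprod y *m B) = 1 by rewrite det_mulmx hy B1 mulr1.
rewrite /F E; have := ln_mxsumM hyB hx; have := ln_mxsumM hy B1; lra.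
Qed.

(** Solve [wprod_cat3] for the product over x: inverses have the same norm, so deleting y costs no
    more than appending it. *)
Lemma lnprod_catl x y : F x <= F (x ++ y) + F y + C.
Proof.
have [B E [B1 /(ln_defect B1) BD]] := wprod_cat3 x y.
have hy := det_wprod y; have hx := det_wprod (x ++ y).
have [iy ily] := ln_mxsum_invmx hy; have [iB ilB] := ln_mxsum_invmx B1.
have xE : wprod x = invmx B *m (invmx (wprod y) *m wprod (x ++ y)).
  by rewrite E -mulmxA mulKmx ?mulKmx// unitmxE ?hy ?B1 unitr1.
have h : \det (invmx (wprod y) *m wprod (x ++ y)) = 1.
  by rewrite det_mulmx iy hx mulr1.
rewrite /F [in leLHS]xE; have := ln_mxsumM iB h; have := ln_mxsumM iy hx; lra.
Qed.

Lemma lnprod_catr x y : F y <= F (x ++ y) + F x + C.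
Proof.
have [B E [B1 /(ln_defect B1) BD]] := wprod_cat3 x y.
have hy := det_wprod x; have hx := det_wprod (x ++ y).
have [iy ily] := ln_mxsum_invmx hy; have [iB ilB] := ln_mxsum_invmx B1.
have xE : wprod y = wprod (x ++ y) *m invmx (wprod x) *m invmx B.
  by rewrite E mulmxK ?mulmxK// unitmxE ?hy ?B1 unitr1.
have h : \det (wprod (x ++ y) *m invmx (wprod x)) = 1.
  by rewrite det_mulmx iy hx mulr1.
rewrite /F [in leLHS]xE; have := ln_mxsumM h iB; have := ln_mxsumM hx iy; lra.
Qed.

(** F + C is subadditive without defect; this is the recursion that [subadditive_ratio_cvg] asks
    for. *)
Lemma lnprod_wpow_cat x k z :
  F (wpow x k ++ z) + C <= k%:R * (F x + C) + (F z + C).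
Proof.
elim: k => [|k IH]; first by rewrite mul0r add0r.
rewrite wpowS -catA -natr1 mulrDl mul1r.
have := lnprod_cat x (wpow x k ++ z); lra.
Qed.

(** The hypothesis on each block already pays for one defect C; [ln 2] is the value of F at the
    empty word. *)
Lemma lnprod_flatten (r : R) bs :
  (forall b, b \in bs -> F b + C <= r * (size b)%:R) ->
  F (flatten bs) <= r * (size (flatten bs))%:R + ln 2.
Proof.
elim: bs => [|b bs IH] bsr; first by rewrite /= mulr0 add0r lnprod_small.
rewrite /= size_cat natrD mulrDr.
have := bsr b (mem_head _ _).
have /IH : forall b, b \in bs -> F b + C <= r * (size b)%:R.
  by move=> c cbs; apply: bsr; rewrite inE cbs orbT.
have := lnprod_cat b (flatten bs); lra.
Qed.

(** Fast growth of the powers forces a large trace, by [ln_mxsum_exp_le]. Completing the last period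
    costs [ln 2 + C] once for the power and once for y. *)
Lemma ln_mxtrace_ge y k : (L <= size y)%N ->
  F (wpow y k.+1) - F y - (ln 2 + C) *+ 2 <=
  k%:R * ln (`|\tr (wprod (y ++ take L y))| + 1).
Proof.
move=> Ly; have := ln_mxsum_exp_le (det_wprod (y ++ take L y)) k.
rewrite -wprod_periodic// -/(F _) -/(F _).
have := lnprod_catl (wpow y k.+1) (take L y); have := lnprod_cat y (take L y).
rewrite (@lnprod_small (take L y)) ?size_take_min ?geq_minl//; lra.
Qed.

Lemma lnprod_wpow_ge y k : (L <= size y)%N ->
  2 <= `|\tr (wprod (y ++ take L y))| ->
  k%:R * ln (`|\tr (wprod (y ++ take L y))| - 1) - (ln 2 + C) <= F (wpow y k).
Proof.
move=> Ly t2; have := ln_mxsum_exp_ge (det_wprod (y ++ take L y)) k t2.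
rewrite -wprod_periodic// -/(F _).
have := lnprod_cat (wpow y k) (take L y).
rewrite (@lnprod_small (take L y)) ?size_take_min ?geq_minl//; lra.
Qed.

End word_product.

(** ** Growth along Sturmian words *)

Section growth.
Variables (R : realType) (alpha : R).
Hypotheses (alpha01 : 0 < alpha < 1) (alpha_irr : irrational alpha).
Local Notation s := (sturm_word alpha).
Local Notation a := (partial_quotient alpha).
Local Notation q n := (size (s n)).

Variables (L : nat) (g : seq bool -> 'M[R]_2) (D : R).
Hypothesis detg : forall w, \det (g w) = 1.
Hypothesis D1 : 1 <= D.
Hypothesis gD : forall w, size w = L.+1 -> mxsum (g w) <= D.
Local Notation F := (lnprod L g).
Local Notation C := (lnprod_defect L D).
Local Notation W := (wprod L g).

Let F0 w : 0 <= F w. Proof. exact: lnprod_ge0. Qed.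
Let C0 : 0 <= C. Proof. exact: lnprod_defect_ge0. Qed.
Let Fcat x y : F (x ++ y) <= F x + F y + C.
Proof. exact: lnprod_cat. Qed.
Let Fcatl x y : F x <= F (x ++ y) + F y + C.
Proof. exact: lnprod_catl. Qed.
Lemma lnprod_sturm_word_ratio : exists2 l : R, 0 <= l &
  forall e, 0 < e -> exists n0, forall n, (n0 <= n)%N ->
    (l - e) * (q n)%:R <= F (s n) + C <= (l + e) * (q n)%:R.
Proof.
apply: (@subadditive_ratio_cvg R (fun n => a n.+2)) => n.
- exact: partial_quotient_gt0.
- by rewrite ltr0n; have [] := size_sturm_word alpha01 alpha_irr n.
- by rewrite ler_nat size_sturm_wordS.
- by rewrite size_sturm_wordSS natrD natrM.
- by rewrite addr_ge0.
- by rewrite sturm_wordSS; exact: lnprod_wpow_cat.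
Qed.

Variable l : R.
Hypothesis l0 : 0 <= l.
Hypothesis lF : forall e, 0 < e -> exists n0, forall n, (n0 <= n)%N ->
  (l - e) * (q n)%:R <= F (s n) + C <= (l + e) * (q n)%:R.

Lemma lnprod_infix_sturm_word_le e : 0 < e -> exists K, forall m x,
  infix x (s m) -> F x <= (l + e) * (size x)%:R + K.
Proof.
move=> e0; have [n h] := lF e0.
(* [k0] bounds F on the incomplete tiles at both ends of x. *)
pose k0 := ln 2 + (q n.+1)%:R * ln D.
exists (k0 + k0 + ln 2 + C + C) => m x xm0.
(* Passing from s_m to s_(m+2n), which has s_m as a suffix, makes the index at least n. *)
have xm : infix x (s (n + (m + n.*2 - n))).
  rewrite subnKC; last by lia.
  exact: infix_suffix_trans xm0 (suffix_sturm_word _ _ _).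
have [bs E bss] := sturm_word_flatten alpha n (m + n.*2 - n).
have bsq b : b \in bs -> (size b <= q n.+1)%N.
  by move=> /bss; rewrite !inE => /orP[]/eqP -> //; exact: size_sturm_wordS.
rewrite E in xm; have [r [bs' [r' [xE rq r'q bs's]]]] := infix_flatten bsq xm.
have k0E y : (size y <= q n.+1)%N -> F y <= k0.
  move=> yq; apply: (le_trans (lnprod_le detg D1 gD _)).
  by rewrite lerD2l ler_wpM2r ?ln_ge0// ler_nat.
have : F (flatten bs') <= (l + e) * (size (flatten bs'))%:R + ln 2.
  apply: (lnprod_flatten detg D1 gD) => b /bs's/bss.
  by rewrite !inE => /orP[]/eqP ->; [have /andP[] := h n (leqnn n) |
    have /andP[] := h n.+1 (leqnSn n)].
have : (l + e) * (size (flatten bs'))%:R <= (l + e) * (size x)%:R.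
  apply: ler_wpM2l; first by rewrite addr_ge0// ltW.
  by rewrite ler_nat xE !size_cat; lia.
have := Fcat r (flatten bs' ++ r'); have := Fcat (flatten bs') r'.
have := k0E r rq; have := k0E r' r'q; rewrite -xE; lra.
Qed.

Lemma size_sturm_word_unbounded (K : R) : exists n0, forall n, (n0 <= n)%N -> K <= (q n)%:R.
Proof.
exists (Num.truncn K).+1 => n Kn.
apply: (@le_trans _ _ (Num.truncn K).+1%:R).
  by case: (lerP 0 K) => K0; [exact/ltW/truncnS_gt | rewrite (le_trans (ltW K0))].
by rewrite ler_nat (leq_trans Kn)// leq_size_sturm_word.
Qed.

(* For [a_n >= 2], submultiplicativity and [|M^k| <= (|tr M| + 1)^(k - 1) |M|]
   force the trace over [s_n] to be exponentially large; [tr M] does not change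
   under cyclic rotation of the word and controls all powers of [M]. *)
Lemma lnprod_power_ge e : 0 < e -> exists K n0, forall n t b, (n0 <= n)%N ->
  s n.+2 = s n.+1 ++ t -> (0 < b <= a n.+3)%N ->
  (l - e) * (b * q n.+2)%:R - K <= F (wpow (s n.+2) b) /\
  (l - e) * (b * q n.+2)%:R - K <= F (wpow (t ++ s n.+1) b).
Proof.
move=> e0; have C2 : 0 <= ln 2 + C + C by rewrite !addr_ge0// ln_ge0// ler1n.
have [el|le] := ltP e l; last first.
  exists 0, 0 => n t b _ _ _.
  by split; apply: le_trans _ (F0 _); rewrite subr0 mulr_le0_ge0// subr_le0.
(* The trace estimate [lntr] costs 6 d and replacing |tr M| + 1 by |tr M| - 1 at most one more d; n
   is taken so large that the constants stay below d |s_(n+2)|. *)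
pose d := e / 8; have d0 : 0 < d by rewrite divr_gt0.
have [n1 h] := lF d0.
have [n2 hK] := size_sturm_word_unbounded ((3 * C + 2 * ln 2 + ln 4) / d).
have [n3 hL] := size_sturm_word_unbounded L%:R.
exists (ln 2 + C + C), (n1 + n2 + n3)%N => n t b nn tE /andP[b0 ba].
have [nn1 nn2 nn3] : [/\ n1 <= n, n2 <= n & n3 <= n]%N by split; clear -nn; lia.
have /andP[h1l h1u] := h n.+1 (leqW nn1).
have /andP[h2l h2u] := h n.+2 (leqW (leqW nn1)).
have /andP[h3l h3u] := h n.+3 (leqW (leqW (leqW nn1))).
have Lq : (L <= q n.+1)%N by rewrite -(ler_nat R) hL// leqW.
have Lq2 : (L <= q n.+2)%N by apply: (leq_trans Lq); exact: size_sturm_wordS.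
have {hK}hK : 3 * C + 2 * ln 2 + ln 4 <= d * (q n.+2)%:R.
  by have := hK n.+2 (leqW (leqW nn2)); rewrite ler_pdivrMr// [_ * d]mulrC.
have q12 : (q n.+1)%:R <= (q n.+2)%:R :> R by rewrite ler_nat size_sturm_wordS.
have q10 : 0 <= (q n.+1)%:R :> R by [].
have ty : size (t ++ s n.+1) = q n.+2 by rewrite tE !size_cat addnC.
have sE3 : s n.+3 = s n.+1 ++ wpow (t ++ s n.+1) (a n.+3).
  by rewrite sturm_wordSS tE wpow_conj.
have qE : (q n.+3)%:R = (a n.+3)%:R * (q n.+2)%:R + (q n.+1)%:R :> R.
  by rewrite size_sturm_wordSS natrD natrM.
have ln2 : 0 <= ln 2 :> R by rewrite ln_ge0// ler1n.
have eE : e = 8 * d by rewrite /d; lra.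
have dq1 : 0 <= d * (q n.+1)%:R by rewrite mulr_ge0// ltW.
have dq2 : d * (q n.+1)%:R <= d * (q n.+2)%:R by rewrite ler_wpM2l// ltW.
rewrite !natrM.
(* For a = 1 only b = 1 occurs: s_(n+2) is covered by the limit, and its rotation by s_(n+3) =
   s_(n+1) (t s_(n+1)). *)
have [a1|a2] := leqP (a n.+3) 1.
  have [b1 a1'] : b = 1%N /\ a n.+3 = 1%N.
    by move: b0 ba a1; clear; lia.
  rewrite b1 mul1r /wpow /= !cats0 eE; split; first by lra.
  move: sE3; rewrite a1' /wpow/= cats0 => sE3.
  have := Fcat (s n.+1) (t ++ s n.+1); rewrite -sE3.
  rewrite qE a1' mul1r in h3l; lra.
set M := W (s n.+2 ++ take L (s n.+2)).
have trE : \tr M = \tr (W ((t ++ s n.+1) ++ take L (t ++ s n.+1))).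
  by rewrite /M tE; exact: mxtrace_wprod_rot.
have a1R : 1 <= (a n.+3).-1%:R :> R by rewrite ler1n -ltnS prednK// ltnW.
have aE : (a n.+3)%:R = (a n.+3).-1%:R + 1 :> R by rewrite natr1 prednK// ltnW.
(* Removing s_(n+1) from s_(n+3) leaves a lower bound for F on s_(n+2)^a; subtracting F of one
   period and dividing by a - 1 >= 1 gives the trace. *)
have lntr : (l - 6 * d) * (q n.+2)%:R <= ln (`|\tr M| + 1).
  have := ln_mxtrace_ge detg D1 gD (a n.+3).-1 Lq2.
  rewrite prednK ?(ltn_trans _ a2)// -/M => hM.
  have := Fcat (wpow (s n.+2) (a n.+3)) (s n.+1); rewrite -sturm_wordSS => hs.
  have ln4 : 0 <= ln 4 :> R by rewrite ln_ge0// ler1n.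
  rewrite -(ler_pM2l (lt_le_trans ltr01 a1R)).
  rewrite qE aE in h3l.
  apply: le_trans _ hM.
  have : d * (q n.+2)%:R <= (a n.+3).-1%:R * (d * (q n.+2)%:R).
    by rewrite ler_peMl// mulr_ge0// ltW.
  move: hs h1u h2u h3l hK dq1 dq2 C0 ln4 ln2.
  move: (F (wpow _ _)) (F (s _)) (F (s _)) (F (s _)) (q n.+1)%:R (q n.+2)%:R => X F1 F2 F3 Q1 Q2.
  move: (_.-1)%:R => A.
  lra.
have lnM4 : ln 4 <= ln (`|\tr M| + 1).
  apply: le_trans _ lntr.
  have : d * (q n.+2)%:R <= (l - 6 * d) * (q n.+2)%:R.
    by rewrite ler_wpM2r//; lra.
  by have := C0; lra.
have M3 : 3 <= `|\tr M|.
  move: lnM4; rewrite ler_ln ?posrE//; lra.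
have lnM1 : (l - e) * (q n.+2)%:R <= ln (`|\tr M| - 1).
  (* |tr M| + 1 <= 2 (|tr M| - 1), because |tr M| >= 3. *)
  have : ln (`|\tr M| + 1) <= ln 2 + ln (`|\tr M| - 1).
    rewrite -lnM ?posrE; [|lra|lra].
    by rewrite ler_ln ?posrE; lra.
  have := C0; have ln4 : ln 2 <= ln 4 :> R by rewrite ler_ln ?posrE//; lra.
  rewrite eE; lra.
have bM : (l - e) * (b%:R * (q n.+2)%:R) <= b%:R * ln (`|\tr M| - 1).
  by rewrite mulrCA ler_wpM2l.
have M2 : 2 <= `|\tr M| by lra.
split.
  by have := lnprod_wpow_ge detg D1 gD b Lq2 M2; rewrite -/M; have := C0; lra.
rewrite trE in M2 bM; rewrite -ty in Lq2.
by have := lnprod_wpow_ge detg D1 gD b Lq2 M2; have := C0; lra.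
Qed.

Let Fsmall K x : (size x <= K)%N -> F x <= ln 2 + K%:R * ln D.
Proof.
move=> xK; apply: (le_trans (lnprod_le detg D1 gD _)).
by rewrite lerD2l ler_wpM2r ?ln_ge0// ler_nat.
Qed.

(* [Fxy] stands for [F (x ++ y)] or [F (y ++ x)]: deleting a piece [y] that is
   not longer than the rest [x] keeps a lower bound on the growth, as the growth
   of [y] is bounded above. *)
Let lnprod_shorten e K K' (x y : seq bool) Fxy : 0 < e ->
  F y <= (l + e) * (size y)%:R + K -> (size y <= size x)%N ->
  (l - e) * (size x + size y)%:R - K' <= Fxy -> Fxy <= F x + F y + C ->
  (l - 3 * e) * (size x)%:R - (K + K' + C) <= F x.
Proof.
move=> e0 hy yx hG GE.
have : e * (size y)%:R <= e * (size x)%:R by rewrite ler_wpM2l ?ler_nat// ltW.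
rewrite natrD in hG; lra.
Qed.

Lemma lnprod_affix_large e : 0 < e -> exists K n0, forall n x, (n0 <= n)%N ->
  prefix x (s n.+3) \/ suffix x (s n.+3) -> (q n.+2 <= size x)%N ->
  (l - e) * (size x)%:R - K <= F x.
Proof.
(* [lnprod_shorten] triples the error. *)
move=> e0; pose d := e / 3; have d0 : 0 < d by rewrite divr_gt0.
have [K hK] := lnprod_infix_sturm_word_le d0.
have [K' [n1 hK']] := lnprod_power_ge d0.
have [n2 h] := lF d0.
exists (K + Num.max K' C + C), (n1 + n2)%N => n x nn xs qx.
have [nn1 nn2] : (n1 <= n)%N /\ (n2 <= n)%N by split; clear -nn; lia.
have -> : e = 3 * d by rewrite /d; lra.
have /prefixP[t tE] := prefix_sturm_wordS alpha01 alpha_irr n.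
have h3 : (l - d) * (q n.+3)%:R - Num.max K' C <= F (s n.+3).
  have /andP[] := h n.+3 (leqW (leqW (leqW nn2))).
  have KC : C <= Num.max K' C by rewrite le_max lexx orbT.
  by lra.
have hb b : (0 < b <= a n.+3)%N ->
    (l - d) * (b * q n.+2)%:R - Num.max K' C <= F (wpow (s n.+2) b) /\
    (l - d) * (b * q n.+2)%:R - Num.max K' C <= F (wpow (t ++ s n.+1) b).
  move=> bb; have [] := hK' n t b nn1 tE bb.
  have KC : K' <= Num.max K' C by rewrite le_max lexx.
  by lra.
have ty : size (t ++ s n.+1) = q n.+2 by rewrite tE !size_cat addnC.
have sE3 : s n.+3 = s n.+1 ++ wpow (t ++ s n.+1) (a n.+3).
  by rewrite sturm_wordSS tE wpow_conj.
case: xs => xs.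
  have [y yx hy] := prefix_sturm_word_extend alpha01 alpha_irr xs qx.
  have GE : F (x ++ y) <= F x + F y + C by exact: Fcat.
  have ys : infix y (s n.+3).
    case: hy => [<-|[b /andP[b0 ba] E]]; first exact: suffix_infix.
    apply: (infix_trans (suffix_infix x y)); rewrite E.
    by rewrite (sturm_wordSS _ n.+1) -(subnKC ba) wpowD -catA prefix_infix.
  apply: (lnprod_shorten d0 (hK _ _ ys) yx _ GE); rewrite -size_cat.
  case: hy => [->//|[b bb ->]]; rewrite size_wpow.
  by have [] := hb b bb.
have [y yx hy] := suffix_sturm_word_extend alpha01 alpha_irr tE xs qx.
have GE : F (y ++ x) <= F x + F y + C by rewrite (addrC (F x)); exact: Fcat.
have ys : infix y (s n.+3).
  case: hy => [<-|[b /andP[b0 ba] E]]; first exact: prefix_infix.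
  apply: (infix_trans (prefix_infix y x)); rewrite E.
  by rewrite sE3 -(subnK ba) wpowD catA suffix_infix.
apply: (lnprod_shorten d0 (hK _ _ ys) yx _ GE); rewrite addnC -size_cat.
case: hy => [->//|[b bb ->]]; rewrite size_wpow ty.
by have [] := hb b bb.
Qed.


Let prefix_sturm_word_small x m n :
  prefix x (s m.+1) -> (size x <= q n.+1)%N -> prefix x (s n.+1).
Proof.
move=> xm; apply: (@prefix_comparable _ _ _ (s (maxn m n).+1)).
  by apply: (prefix_trans xm); apply: prefix_sturm_word; rewrite ?leq_maxl.
by apply: prefix_sturm_word; rewrite ?leq_maxr.
Qed.

Let suffix_sturm_word_small x m n : odd m = odd n ->
  suffix x (s m) -> (size x <= q n)%N -> suffix x (s n).
Proof.
move=> mn xm; have max_mn i : odd i = odd m -> (i <= maxn m n)%N ->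
    suffix (s i) (s (maxn m n)).
  move=> im ile; have -> : maxn m n = (i + (maxn m n - i)./2.*2)%N.
    rewrite halfK oddB// maxnE; rewrite maxnE in ile; lia.
  exact: suffix_sturm_word.
apply: (@suffix_comparable _ _ _ (s (maxn m n))).
  by apply: (suffix_trans xm); apply: max_mn; rewrite ?leq_maxl.
by apply: max_mn; rewrite ?leq_maxr.
Qed.

Let lnprod_swap (x e e' : seq bool) : size e = 2%N -> size e' = 2%N ->
  F (x ++ e') <= F (x ++ e) + (ln 2 + 2 * ln D + C) *+ 2.
Proof.
move=> se se'; have := Fcat x e'; have := Fcatl x e.
by have := @Fsmall 2 e; have := @Fsmall 2 e'; rewrite se se' => /(_ isT) + /(_ isT); lra.
Qed.

(** Apply [lnprod_affix_large] at the least k with |x| <= |s_k|, so that |s_(k-1)| < |x|. Prefixes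
    of any s_m of this length are prefixes of s_k; for suffixes the parities of m and k matter. *)
Lemma lnprod_affix_ge e : 0 < e -> exists K, forall n x,
  prefix x (s n.+1) \/ suffix x (s n) -> (l - e) * (size x)%:R - K <= F x.
Proof.
move=> e0; have [K [n0 hK]] := lnprod_affix_large e0.
pose K2 := (ln 2 + 2 * ln D + C) *+ 2.
have K20 : 0 <= K2.
  by rewrite mulrn_wge0// !addr_ge0// ?mulr_ge0 ?ln_ge0// ler1n.
(* [K2] pays for exchanging the last two letters; the last summand settles short x, where only F >=
   0 is used. *)
exists (`|K| + K2 + l * (q n0.+2)%:R) => m x xm.
have K0 := ler_norm K.
have lq0 : 0 <= l * (q n0.+2)%:R by rewrite mulr_ge0.
have [xq|qx] := leqP (size x) (q n0.+2).
  have h1 : l * (size x)%:R <= l * (q n0.+2)%:R by rewrite ler_wpM2l// ler_nat.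
  have h2 : 0 <= e * (size x)%:R by rewrite mulr_ge0// ltW.
  have := F0 x; have := normr_ge0 K; lra.
have xk : exists k, (size x <= q k)%N.
  by exists (size x); exact: leq_size_sturm_word.
case: (ex_minnP xk) => k xqk kmin.
have kn0 : (n0.+2 < k)%N.
  rewrite ltnNge; apply/negP => kn.
  have : (q k <= q n0.+2)%N by apply: size_sturm_word_homo.
  by move/(leq_trans xqk); rewrite leqNgt qx.
case: k => [//|[//|[//|n]]] in xqk kmin kn0 *.
have nn0 : (n0 <= n)%N by [].
have qxn : (q n.+2 < size x)%N.
  by rewrite ltnNge; apply/negP => xq; have := kmin _ xq; rewrite ltnn.
suff : (l - e) * (size x)%:R - K - K2 <= F x by lra.
have large y : size y = size x -> prefix y (s n.+3) \/ suffix y (s n.+3) ->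
    (l - e) * (size x)%:R - K <= F y.
  by move=> yx yn; rewrite -yx; apply: (hK n) => //; rewrite yx ltnW.
case: xm => xm.
  by have := large x erefl (or_introl (prefix_sturm_word_small xm xqk)); lra.
have [mn|mn] := eqVneq (odd m) (odd n.+3).
  by have := large x erefl (or_intror (suffix_sturm_word_small mn xm xqk)); lra.
(* In the wrong parity x is a suffix of s_(n+4), hence of s_(n+3) s_(n+2). Exchanging its last two
   letters makes it a suffix of s_(n+2) s_(n+3), hence of s_(n+3). *)
have {}mn : odd m = odd n.+4 by move: mn => /=; case: (odd m); case: (odd n).
have xcat : suffix x (s n.+3 ++ s n.+2).
  apply: (@suffix_comparable _ _ _ (s n.+4)).
  - apply: suffix_sturm_word_small mn xm _.
    exact: leq_trans xqk (size_sturm_wordS alpha01 alpha_irr _).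
  - exact: suffix_sturm_word_cat.
  - by rewrite size_cat (leq_trans xqk)// leq_addr.
have [z [e1 [e2 [se1 se2 E1 E2]]]] := sturm_word_near_comm alpha n.+2.
have x2 : (2 <= size x)%N.
  by apply: leq_trans (ltnW qxn); apply: leq_trans _ (leq_size_sturm_word alpha01 alpha_irr _).
have /suffixP[x0 xE] : suffix e1 x.
  apply: suffix_comparable (suffix_suffix z e1) _ _; last by rewrite se1.
  by rewrite -E1.
have x0z : suffix x0 z.
  by move: xcat; rewrite E1 xE suffix_catl// eqxx.
have sx : size (x0 ++ e2) = size x by rewrite xE !size_cat se1 se2.
have : suffix (x0 ++ e2) (s n.+3).
  apply: suffix_comparable _ (suffix_suffix (s n.+2) (s n.+3)) _; last by rewrite sx.
  by rewrite E2 suffix_catl// eqxx.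
move=> h; have := large _ sx (or_intror h).
by have := lnprod_swap x0 se1 se2; rewrite -xE -/K2; lra.
Qed.

Lemma lnprod_affix_bound e : 0 < e -> exists K, forall n x,
  prefix x (s n.+1) \/ suffix x (s n) ->
  (l - e) * (size x)%:R - K <= F x <= (l + e) * (size x)%:R + K.
Proof.
move=> e0; have [K hK] := lnprod_affix_ge e0.
have [K' hK'] := lnprod_infix_sturm_word_le e0.
exists (Num.max K K') => n x xn; apply/andP; split.
  have KK : K <= Num.max K K' by rewrite le_max lexx.
  by have := hK n x xn; lra.
have KK : K' <= Num.max K K' by rewrite le_max lexx orbT.
have [m xm] : exists m, infix x (s m).
  by case: xn => xn; [exists n.+1; exact: prefixW | exists n; exact: suffixW].
by have := hK' m x xm; lra.
Qed.

End growth.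

(** ** The leading sequences *)

Lemma infix_drop_take (T : eqType) (y : seq T) i j :
  infix (drop i y ++ take j y) (y ++ y).
Proof.
apply/infixP; exists (take i y), (drop j y).
by rewrite !catA cat_take_drop -catA cat_take_drop.
Qed.

(** The case k = 1 matters: there the second period comes from z. *)
Lemma prefix_wpow_square (T : eqType) (y z : seq T) L k :
  prefix (y ++ take L y) z -> (0 < k)%N ->
  prefix (y ++ y ++ take L y) (wpow y k ++ z).
Proof.
move=> yz; case: k => // k _; rewrite wpowS -catA prefix_catl2.
apply: (@prefix_trans _ (wpow y k ++ y ++ take L y)); last first.
  by rewrite prefix_catl2.
case: k => [|k]; first exact: prefix_refl.
rewrite wpowS -catA prefix_catl2; apply: prefix_trans (prefix_take _ _) _.
by rewrite catA -wpowSr wpowS -catA prefix_prefix.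
Qed.

Section limit_words.
Variables (R : realType) (alpha : R).
Hypotheses (alpha01 : 0 < alpha < 1) (alpha_irr : irrational alpha).
Local Notation s := (sturm_word alpha).
Local Notation q n := (size (s n)).

(* [par = false] for [u_word] and [par = true] for [v_word]. *)
Definition sturm_limit_word (par : bool) (w : int -> bool) : Prop :=
  (forall n m, (m <= q n.+1)%N -> subword w 1 m = take m (s n.+1)) /\
  (forall n m, odd n = par -> (m <= q n)%N ->
    subword w (1 - m%:Z) m = drop (q n - m) (s n)).

Let subword_right (d : int -> bool) n m : (m <= q n.+1)%N ->
  subword (fun i => if 0 < i then c_word alpha i else d i) 1 m = take m (s n.+1).
Proof.
move=> mq; apply: (@eq_from_nth _ false); first by rewrite size_subword size_takel.
move=> i; rewrite size_subword => im; rewrite nth_subword// nth_take//.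
have -> : 1 + i%:Z = i.+1%:Z by lia.
by rewrite /= (@c_wordE _ _ alpha01 alpha_irr n)//; exact: leq_trans im mq.
Qed.

Let subword_left (c d : int -> bool) (x : seq bool) m : (m <= size x)%N ->
  (forall i, (i < size x)%N -> d (- i%:Z) = nth false (rev x) i) ->
  subword (fun i => if 0 < i then c i else d i) (1 - m%:Z) m =
  drop (size x - m) x.
Proof.
move=> mx dE; apply: (@eq_from_nth _ false).
  by rewrite size_subword size_drop subKn.
move=> i; rewrite size_subword => im; rewrite nth_subword// nth_drop.
have -> : 1 - m%:Z + i%:Z = - (m - i.+1)%N%:Z by lia.
rewrite ifF; last by apply/negbTE; rewrite -leNgt oppr_le0.
rewrite dE ?nth_rev; [congr nth; lia|lia|lia].
Qed.

Lemma sturm_limit_word_u : sturm_limit_word false (u_word alpha).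
Proof.
split=> [n m|n m n0 mq]; first exact: subword_right.
apply: subword_left => // i iq.
have nE : n = n./2.*2 by rewrite -[LHS]odd_double_half n0.
by rewrite nE in iq *; exact: d_wordE.
Qed.

Lemma sturm_limit_word_v : sturm_limit_word true (v_word alpha).
Proof.
split=> [n m|n m n1 mq]; first exact: subword_right.
apply: subword_left => // i iq.
have nE : n = n./2.*2.+1 by rewrite -[LHS]odd_double_half n1.
by rewrite nE in iq *; exact: e_wordE.
Qed.

Section one_word.
Variables (par : bool) (w : int -> bool).
Hypothesis wlim : sturm_limit_word par w.

Lemma sturm_limit_word_prefix x n : prefix x (s n.+1) ->
  subword w 1 (size x) = x.
Proof.
by move=> xs; rewrite (wlim.1 n) ?size_prefix//; move: xs; rewrite prefixE => /eqP.
Qed.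

Lemma sturm_limit_word_suffix x n : odd n = par -> suffix x (s n) ->
  subword w (1 - (size x)%:Z) (size x) = x.
Proof.
by move=> np xs; rewrite (wlim.2 n) ?size_suffix//; move: xs; rewrite suffixE => /eqP.
Qed.

Lemma prefix_sturm_limit_word m : exists n, prefix (subword w 1 m) (s n.+1).
Proof.
exists m; rewrite (wlim.1 m) ?prefix_take//.
exact: leq_trans (leqnSn m) (leq_size_sturm_word alpha01 alpha_irr _).
Qed.

Lemma suffix_sturm_limit_word m :
  exists n, suffix (subword w (1 - m%:Z) m) (s n).
Proof.
exists (m.*2 + par)%N; have op : odd (m.*2 + par) = par.
  by rewrite oddD odd_double oddb.
rewrite (wlim.2 _ _ op) ?suffix_drop//.
apply: leq_trans _ (leq_size_sturm_word alpha01 alpha_irr _); lia.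
Qed.

(** Every window lies in a symmetric one around the origin, which is a suffix of some s_j followed
    by a prefix of it and so a factor of s_j s_j. *)
Lemma sturm_limit_word_subshift : sturm_subshift alpha w.
Proof.
move=> k n; have [M kM] : exists M : nat, (absz k + n < M)%N by exists (absz k + n).+1.
have [p [t E]] := @subword_inner _ w (1 - M%:Z) k (M + M) n ltac:(lia) ltac:(lia).
have Mq (j : nat) : (M <= j)%N -> (M <= q j)%N.
  by move=> Mj; exact: leq_trans Mj (leq_size_sturm_word alpha01 alpha_irr _).
pose j := (M.*2 + par).+2.
have jp : odd j = par by rewrite /j /= negbK oddD odd_double oddb.
have Mj : (M <= j)%N by rewrite /j; lia.
exists j.+3; apply: infix_trans _ (infix_sturm_word_sq alpha01 alpha_irr _).
apply: (@infix_trans _ (subword w (1 - M%:Z) (M + M))).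
  by rewrite E infix_infix.
have rE : subword w 1 M = take M (s j) by apply: (wlim.1 j.-1); exact: Mq.
rewrite subwordD (wlim.2 j)// ?Mq// subrK rE.
exact: infix_drop_take.
Qed.

(** On the right w begins with s_(n+3) s_(n+2) = s_(n+2)^a s_(n+1) s_(n+2). Its tail s_(n+1) s_(n+2)
    agrees with s_(n+2) s_(n+1) except for two letters, whence L + 2 in the hypothesis. *)
Lemma sturm_limit_word_square L n : odd n = par -> (L.+2 <= q n.+1)%N ->
  subword w 1 (q n.+2 + q n.+2 + L) =
    s n.+2 ++ s n.+2 ++ take L (s n.+2).
Proof.
move=> np Lq; set y := s n.+2.
have yL (z : seq bool) : prefix (y ++ y ++ take L y) z -> prefix z (s n.+4) ->
   subword w 1 (size y + size y + L) = y ++ y ++ take L y.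
  move=> h1 h2; rewrite -(@sturm_limit_word_prefix (y ++ y ++ take L y) n.+3).
    by rewrite !size_cat size_takel ?addnA//; apply: leq_trans (size_sturm_wordS _ _ n.+1) => //; lia.
  exact: prefix_trans h1 h2.
apply: yL (prefix_sturm_word_cat alpha01 alpha_irr n.+1).
have [z [e [e' [se se' E E']]]] := sturm_word_near_comm alpha n.+1.
rewrite (sturm_wordSS _ n.+1) -catA E' -/y.
have yz : prefix (y ++ take L y) z.
  apply: (@prefix_comparable _ _ _ (z ++ e)) (prefix_prefix z e) _.
    rewrite -E prefix_catl2; apply: prefix_comparable (prefix_take _ _) _ _.
      exact: prefix_sturm_wordS.
    by rewrite size_take_min geq_min (leq_trans _ Lq)// ltnW.
  have zE : (size z + 2 = size y + q n.+1)%N by rewrite -se -size_cat -E size_cat.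
  have Ly : (L <= size y)%N.
    apply: leq_trans (size_sturm_wordS alpha01 alpha_irr n.+1).
    exact: leq_trans (leqnSn _) (leq_trans (leqnSn _) Lq).
  have yz : (size y + L <= size z)%N by clear -zE Lq; lia.
  by rewrite size_cat size_takel.
apply: prefix_trans (prefix_wpow_square yz _) _.
  exact: (partial_quotient_gt0 n.+2 alpha01 alpha_irr).
by rewrite prefix_catl2 prefix_prefix.
Qed.

End one_word.

End limit_words.

(** * Cocycles as products along subwords *)

Section cocycle.
Variables (R : realType) (S : eqType) (A : (int -> S) -> 'M[R]_2) (w : int -> S).

Lemma subwordS (i : int) k : subword w i k.+1 = w i :: subword w (i + 1) k.
Proof.
by rewrite -add1n subwordD -[RHS]cat1s {1}/subword /= addr0.
Qed.

Lemma cocycleS (m : int) : (forall k, \det (A (shiftz k w)) = 1) ->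
  cocycle A (m + 1) w = A (shiftz m w) *m cocycle A m w.
Proof.
move=> A1; case: m => [n|[|n]].
- by rewrite /cocycle (_ : n%:Z + 1 = n.+1%:Z); last by lia.
- rewrite /cocycle/= (_ : Negz 0 = -1)// mulmx1 mulmxV//.
  by rewrite unitmxE A1 unitr1.
- rewrite (_ : Negz n.+1 + 1 = Negz n); last by lia.
  rewrite /cocycle /= mulKVmx// (_ : Negz n.+1 = - n.+2%:Z)//.
  by rewrite unitmxE A1 unitr1.
Qed.

(** The k factors from time m on read the letters from m - N to m + k - 1 + N, which are k + 2 N in
    number. *)
Lemma cocycle_wprod (N : nat) (g : seq S -> 'M[R]_2) (m : int) k :
  (forall x, \det (g x) = 1) ->
  (forall j, A (shiftz j w) = g (subword w (j - N%:Z) N.*2.+1)) ->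
  cocycle A (m + k%:Z) w =
    wprod N.*2 g (subword w (m - N%:Z) (k + N.*2)) *m cocycle A m w.
Proof.
move=> g1 Ag; have A1 j : \det (A (shiftz j w)) = 1 by rewrite Ag.
elim: k m => [|k IH] m.
  by rewrite addr0 wprod_small ?mul1mx// size_subword.
have -> : m + k.+1%:Z = (m + 1) + k%:Z by lia.
rewrite IH cocycleS// mulmxA; congr (_ *m _).
rewrite addSn subwordS /= size_subword ltnS leq_addl Ag.
rewrite (_ : m + 1 - N%:Z = m - N%:Z + 1); last by lia.
congr (_ *m g _); rewrite subwordS; congr (_ :: _).
by rewrite addnC subwordD take_size_cat// size_subword.
Qed.

End cocycle.

(** * Locally constant maps as functions of finite windows *)

Section locally_constant.
Variables (R : realType) (S : eqType) (Omega : set (int -> S)).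
Variable A : (int -> S) -> 'M[R]_2.

(** Makes the window radius positive, so that the cocycle word at time n has exactly n + N letters
    right of the origin when the radius is N + 1. *)
Lemma locally_constant_onS (N : nat) :
  (forall w w', Omega w -> Omega w' -> subword w (- N%:Z) N.*2.+1 =
    subword w' (- N%:Z) N.*2.+1 -> A w = A w') ->
  forall w w', Omega w -> Omega w' -> subword w (- N.+1%:Z) N.+1.*2.+1 =
    subword w' (- N.+1%:Z) N.+1.*2.+1 -> A w = A w'.
Proof.
move=> h w w' Ow Ow' E; apply: h => //.
have subE (z : int -> S) : subword z (- N%:Z) N.*2.+1 =
    take N.*2.+1 (drop 1 (subword z (- N.+1%:Z) N.+1.*2.+1)).
  rewrite (_ : N.+1.*2.+1 = 1 + (N.*2.+1 + 1))%N; last by lia.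
  rewrite subwordD drop_size_cat ?size_subword// subwordD take_size_cat ?size_subword//.
  congr subword; lia.
by rewrite !subE E.
Qed.

(** Words that do not occur are sent to the identity, so that the determinant is 1 on all words. *)
Lemma local_rule (N : nat) : SL2_valued Omega A ->
  (forall w w', Omega w -> Omega w' -> subword w (- N%:Z) N.*2.+1 =
    subword w' (- N%:Z) N.*2.+1 -> A w = A w') ->
  exists2 g : seq S -> 'M[R]_2, forall x, \det (g x) = 1 &
    forall w, Omega w -> A w = g (subword w (- N%:Z) N.*2.+1).
Proof.
move=> A1 hA; have /choice[g hg] : forall x, exists M : 'M[R]_2, \det M = 1 /\
    forall w, Omega w -> subword w (- N%:Z) N.*2.+1 = x -> A w = M.
  move=> x.
  have [[w [Ow wx]]|h] := pselect (exists w, Omega w /\ subword w (- N%:Z) N.*2.+1 = x).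
    exists (A w); split; first exact: A1.
    by move=> w' Ow' w'x; apply: hA => //; rewrite wx w'x.
  exists 1%:M; split; first exact: det1.
  by move=> w Ow wx; case: h; exists w.
exists g => [x|w Ow]; first by have [] := hg x.
by have [_] := hg (subword w (- N%:Z) N.*2.+1); exact.
Qed.

End locally_constant.

Lemma mxsum_word_bound (R : realType) (S : finType) (g : seq S -> 'M[R]_2) n :
  exists2 D, 1 <= D & forall x, size x = n -> mxsum (g x) <= D.
Proof.
exists (1 + \sum_(t : n.-tuple S) mxsum (g t)).
  by rewrite lerDl sumr_ge0// => t _; exact: mxsum_ge0.
move=> x xn; have -> : x = in_tuple x by [].
move: (in_tuple x) => t; rewrite xn in t *.
rewrite (bigD1 t)//= addrCA lerDl addr_ge0// sumr_ge0// => t' _.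
exact: mxsum_ge0.
Qed.

Lemma cvg_ratio_linear (R : realType) (f : nat -> R) (l : R) :
  (forall e, 0 < e -> exists K, forall n, `|f n - l * n%:R| <= e * n%:R + K) ->
  f n / n%:R @[n --> \oo] --> l.
Proof.
move=> h; apply/cvgrPdist_le => e e0.
have [K hK] := h (e / 2) ltac:(by rewrite divr_gt0).
exists (Num.truncn (K / (e / 2))).+1 => // n /= Kn.
have n0 : 0 < n%:R :> R by rewrite ltr0n (leq_trans _ Kn).
have Kne : K <= e / 2 * n%:R.
  rewrite mulrC -ler_pdivrMr ?divr_gt0//.
  have [K0|K0] := ltP (K / (e / 2)) 0; first by rewrite (le_trans (ltW K0)).
  by apply: (le_trans (ltW (truncnS_gt _))); rewrite // ler_nat.
have -> : l - f n / n%:R = - ((f n - l * n%:R) / n%:R).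
  by field; rewrite gt_eqF.
rewrite normrN normrM normfV (gtr0_norm n0) ler_pdivrMr//.
by have := hK n; lra.
Qed.

Lemma ln_decay (R : realType) (x : nat -> R) (l e : R) : l < 0 -> 0 < e ->
  n%:R^-1 * ln (x n) @[n --> \oo] --> l ->
  exists n0, forall n, (n0 <= n)%N -> x n <= e.
Proof.
move=> l0 e0 /cvgrPdist_le/(_ (- l / 2)) []; first by rewrite divr_gt0// oppr_gt0.
move=> n0 _ h; pose k := (Num.truncn (ln e / (l / 2))).+1.
exists (maxn n0 k) => n; rewrite geq_max => /andP[nn kn].
have := h n nn; rewrite ler_distlC => /andP[_ hn].
have n1 : 0 < n%:R :> R by rewrite ltr0n (leq_trans _ kn).
have {}hn : ln (x n) <= n%:R * (l / 2).
  by rewrite -ler_pdivrMl//; lra.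
rewrite leNgt; apply/negP => ex.
have : ln e < ln (x n) by rewrite ltr_ln ?posrE// (lt_trans e0).
have : n%:R * (l / 2) <= ln e.
  rewrite -ler_ndivrMr; last by lra.
  have [K0|K0] := ltP (ln e / (l / 2)) 0; first by rewrite (le_trans (ltW K0))// ltW.
  by apply: (le_trans (ltW (truncnS_gt _))); rewrite // ler_nat.
lra.
Qed.

(** * Growth and decay of the cocycle along u and v *)

Section sturm_cocycle.
Variables (R : realType) (alpha : R).
Hypotheses (alpha01 : 0 < alpha < 1) (alpha_irr : irrational alpha).
Local Notation s := (sturm_word alpha).
Local Notation q n := (size (s n)).

Variables (A : (int -> bool) -> 'M[R]_2) (N : nat) (g : seq bool -> 'M[R]_2).
Local Notation L := (N.+1.*2).
Local Notation W := (wprod L g).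
Hypothesis detg : forall x, \det (g x) = 1.
Hypothesis Ag : forall w, sturm_subshift alpha w ->
  A w = g (subword w (- N.+1%:Z) L.+1).

Section one_word.
Variables (par : bool) (w : int -> bool).
Hypothesis wlim : sturm_limit_word alpha par w.

Let Agw j : A (shiftz j w) = g (subword w (j - N.+1%:Z) L.+1).
Proof.
rewrite Ag; last first.
  exact/shiftz_sturm_subshift/(sturm_limit_word_subshift alpha01 alpha_irr wlim).
by rewrite subword_shiftz addrC.
Qed.

Let cocycleW (m : int) k : cocycle A (m + k%:Z) w =
  W (subword w (m - N.+1%:Z) (k + L)) *m cocycle A m w.
Proof. exact: (cocycle_wprod _ _ detg Agw). Qed.

Lemma det_cocycle m : \det (cocycle A m w) = 1.
Proof.
have [[n ->]|[n ->]] : (exists n : nat, m = n%:Z) \/ exists n : nat, m = - n%:Z.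
- by case: m => n; [left; exists n | right; exists n.+1].
- have := cocycleW 0 n; rewrite add0r => ->.
  by rewrite det_mulmx det_wprod// mul1r /cocycle/= det1.
have := congr1 (@determinant _ _) (cocycleW (- n%:Z) n).
by rewrite addNr det_mulmx det_wprod// mul1r => <-; rewrite /cocycle /= det1.
Qed.

Lemma cocycle_decay : forall v : 'cV[R]_2, v != 0 ->
  ~ exists l1 l2 : R,
      [/\ n%:R^-1 * ln (vnorm2 (cocycle A n%:Z w *m v)) @[n --> \oo] --> l1,
          n%:R^-1 * ln (vnorm2 (cocycle A (- n%:Z) w *m v)) @[n --> \oo] --> l2,
          l1 < 0 & l2 < 0].
Proof.
move=> v v0 [l1 [l2 [h1 h2 l10 l20]]].
(* From time N + 2 on, with radius N + 1, the letters read start at position 1, where the repetition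
   starts. *)
pose v' := cocycle A N.+2%:Z w *m v.
have v'0 : 0 < mxsum v'.
  rewrite lt_neqAle mxsum_ge0 andbT eq_sym mxsum_eq0; apply/eqP => v'0.
  move/eqP: v0; apply; have := congr1 (mulmx (invmx (cocycle A N.+2%:Z w))) v'0.
  by rewrite mulmx0 mulKmx// unitmxE det_cocycle unitr1.
(* Three vectors of Euclidean norm at most e have [mxsum] at most 6 e in all, less than that of
   [v']. *)
pose e := mxsum v' / 8; have e0 : 0 < e by rewrite divr_gt0.
have [n1 hn1] := ln_decay l10 e0 h1.
have [n2 hn2] := ln_decay l20 e0 h2.
pose n := ((n1 + n2 + N.*2.+4).*2 + par)%N.
have np : odd n = par by rewrite /n oddD odd_double oddb.
have nq m : (n <= m)%N -> (n <= q m)%N.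
  by move=> nm; exact: leq_trans nm (leq_size_sturm_word alpha01 alpha_irr _).
have nB : [/\ (n1 <= n)%N, (n2 + N.+2 <= n)%N & (L.+2 <= n)%N].
  by split; rewrite /n; lia.
have [nB1 nB2 nB3] := nB.
have sq := sturm_limit_word_square alpha01 alpha_irr wlim np
  (leq_trans nB3 (nq _ (leqnSn _))).
have nq2 : (n <= q n.+2)%N by apply: nq; rewrite ltnW.
have sleft := sturm_limit_word_suffix wlim (_ : odd n.+2 = par) (suffix_refl (s n.+2)).
have {}sleft : subword w (1 - (q n.+2)%:Z) (q n.+2) = s n.+2.
  by apply: sleft; rewrite /= negbK.
move: sq sleft nq2; set y := s n.+2; clearbody y => sq sleft nq2.
have Ly : (L <= size y)%N by lia.
have {}sq : subword w 1 (size y) = y /\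
    subword w 1 (size y + L) = y ++ take L y /\
    subword w (1 + (size y)%:Z) (size y + L) = y ++ take L y.
  move: sq; rewrite -addnA subwordD => /eqP.
  rewrite eqseq_cat ?size_subword// => /andP[/eqP E1 /eqP E2].
  split=> //; split=> //; rewrite subwordD E1; congr (_ ++ _).
  move: E2 => /(congr1 (take L)); rewrite [(size y + L)%N]addnC subwordD.
  by rewrite take_size_cat ?size_subword// takel_cat.
have [sq1 [sq2 sq3]] := sq.
(* The same M advances the cocycle by one period from the times N + 2 - |y|, N + 2 and N + 2 +
   |y|. *)
pose M := W (y ++ take L y).
have M1 : \det M = 1 by exact: det_wprod.
have := cocycleW N.+2%:Z (size y).
rewrite (_ : N.+2%:Z - N.+1%:Z = 1); last by lia.
rewrite sq2 -/M => E1.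
have := cocycleW (N.+2%:Z + (size y)%:Z) (size y).
rewrite (_ : N.+2%:Z + (size y)%:Z - N.+1%:Z = 1 + (size y)%:Z); last by lia.
rewrite sq3 -/M E1 => E2.
have := cocycleW (N.+2%:Z - (size y)%:Z) (size y).
rewrite (_ : N.+2%:Z - (size y)%:Z - N.+1%:Z = 1 - (size y)%:Z); last by lia.
rewrite subrK subwordD sleft subrK.
rewrite (_ : subword w 1 L = take L y); last first.
  move: sq1 => /(congr1 (take L)); rewrite -{1}(subnKC Ly) subwordD.
  by rewrite take_size_cat ?size_subword.
rewrite -/M => E3.
have := gordon M1 v'.
have small (z : 'cV[R]_2) : vnorm2 z <= e -> mxsum z <= 2 * e.
  by move=> ze; apply: (le_trans (mxsum_le_vnorm2 z)); rewrite ler_wpM2l.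
have : mxsum (M *m v') <= 2 * e.
  apply: small; rewrite /v' mulmxA -E1.
  have -> : N.+2%:Z + (size y)%:Z = (N.+2 + size y)%N%:Z by lia.
  by apply: hn1; lia.
have : mxsum (M *m (M *m v')) <= 2 * e.
  rewrite (_ : M *m (M *m v') = cocycle A (N.+2%:Z + (size y)%:Z + (size y)%:Z) w *m v);
    last by rewrite E2 /v' !mulmxA.
  apply: small.
  have -> : N.+2%:Z + (size y)%:Z + (size y)%:Z = (N.+2 + size y + size y)%N%:Z by lia.
  by apply: hn1; lia.
have : mxsum (invmx M *m v') <= 2 * e.
  apply: small; rewrite /v' mulmxA E3 mulKmx; last by rewrite unitmxE M1 unitr1.
  have -> : N.+2%:Z - (size y)%:Z = - (size y - N.+2)%N%:Z by lia.
  by apply: hn2; lia.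
rewrite /e; lra.
Qed.

Variable D : R.
Hypothesis D1 : 1 <= D.
Hypothesis gD : forall x, size x = L.+1 -> mxsum (g x) <= D.
Local Notation F := (lnprod L g).
Local Notation C := (lnprod_defect L D).

(** The word read up to time n or -n is, up to a bounded piece across the origin, a prefix of c or a
    suffix of the left half of w. *)
Lemma cocycle_growth (l : R) :
  (forall e, 0 < e -> exists K, forall n x,
    prefix x (s n.+1) \/ suffix x (s n) ->
    (l - e) * (size x)%:R - K <= F x <= (l + e) * (size x)%:R + K) ->
  (ln (opnorm2 (cocycle A n%:Z w)) / n%:R @[n --> \oo] --> l) /\
  (ln (opnorm2 (cocycle A (- n%:Z) w)) / n%:R @[n --> \oo] --> l).
Proof.
move=> hF.
have close (h : nat -> R) (K1 : R) (k : nat) (x : nat -> seq bool) :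
    (forall n, `|h n - F (x n)| <= K1) ->
    (forall n, size (x n) = (n + k)%N) ->
    (forall n, exists m, prefix (x n) (s m.+1) \/ suffix (x n) (s m)) ->
    h n / n%:R @[n --> \oo] --> l.
  move=> hx xk xs; apply: cvg_ratio_linear => e e0.
  have [K hK] := hF e e0.
  exists (K + K1 + e * k%:R + `|l * k%:R|) => n.
  have [m /hK] := xs n; have := hx n; rewrite !ler_norml xk natrD.
  have := ler_norm (l * k%:R); have := ler_norm (- (l * k%:R)).
  rewrite normrN => *; lra.
have cocycle0 : cocycle A 0 w = 1%:M by [].
have bound (M : 'M[R]_2) x z : \det M = 1 -> ln (mxsum M) = F (x ++ z) ->
    `|ln (opnorm2 M) - F z| <= ln 4 + F x + C /\
    `|ln (opnorm2 M) - F x| <= ln 4 + F z + C.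
  move=> M1 ME; have := ln_opnorm2 M1; rewrite ME !ler_norml.
  have := lnprod_cat detg D1 gD x z; have := lnprod_catl detg D1 gD x z.
  have := lnprod_catr detg D1 gD x z; have := lnprod_ge0 L detg x.
  have := lnprod_ge0 L detg z; have := lnprod_defect_ge0 L D1.
  by move=> *; split; lra.
split.
  apply: (@close _ (ln 4 + F (subword w (- N.+1%:Z) N.+2) + C) N
    (fun n => subword w 1 (n + N))).
  - move=> n; apply: (bound _ _ _ _ _).1; first exact: det_cocycle.
    have := cocycleW 0 n; rewrite !add0r cocycle0 mulmx1 => ->.
    rewrite /lnprod (_ : n + L = N.+2 + (n + N))%N; last by lia.
    rewrite subwordD; congr (ln (mxsum (W (_ ++ subword _ _ _)))); lia.
  - by move=> n; rewrite size_subword.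
  - by move=> n; have [m] := prefix_sturm_limit_word alpha01 alpha_irr wlim (n + N);
      exists m; left.
apply: (@close _ (ln 4 + F (subword w 1 N) + C) N.+2
  (fun n => subword w (1 - (n + N.+2)%N%:Z) (n + N.+2))).
- move=> n; apply: (bound _ _ _ _ _).2; first exact: det_cocycle.
  have := cocycleW (- n%:Z) n; rewrite addNr cocycle0.
  set V := W _ => VE; have V1 : \det V = 1 by exact: det_wprod.
  (* Backwards the cocycle inverts the product over the word left of the origin, and inversion
     preserves [mxsum]. *)
  have -> : cocycle A (- n%:Z) w = invmx V.
    rewrite -[RHS]mulmx1 VE mulKmx// unitmxE V1 unitr1//.
  rewrite mxsum_invmx// /lnprod /V (_ : n + L = (n + N.+2) + N)%N; last by lia.
  rewrite subwordD.
  congr (ln (mxsum (W (subword _ _ _ ++ subword _ _ _)))); lia.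
- by move=> n; rewrite size_subword.
- by move=> n; have [m ms] := suffix_sturm_limit_word alpha01 alpha_irr wlim (n + N.+2);
    exists m; right.
Qed.

End one_word.

End sturm_cocycle.

(** * Verification of the conditions of (LSC) *)

Theorem lemma6p1 (R : realType) (alpha : R) (alpha_gt0 : 0 < alpha)
    (alpha_lt1 : alpha < 1) (alpha_irrational : irrational alpha) :
  LSC R (sturm_subshift alpha) (tnth [tuple u_word alpha; v_word alpha]).
Proof.
have alpha01 : 0 < alpha < 1 by rewrite alpha_gt0.
set omega := tnth _.
have omega_lim j : sturm_limit_word alpha (j == 1) (omega j).
  case: j => -[|[|//]] i; rewrite /omega (tnth_nth (u_word alpha))/=.
    exact: sturm_limit_word_u.
  exact: sturm_limit_word_v.
have omegaS j : sturm_subshift alpha (omega j).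
  exact: sturm_limit_word_subshift (omega_lim j).
split=> //.
  exists 0 => n _; apply/seteqP; split=> x.
    move=> [w Ow [k xE]]; have [m xm] := Ow k n; rewrite -xE in xm.
    have sx : size x = n by rewrite xE size_subword.
    have [l [r [j [i [xlr ls rs]]]]] := infix_sturm_word_cut alpha01 alpha_irrational xm.
    (* The parity of j decides whether the suffix of s_j is read left of the origin in u or in v;
       the prefix of c follows in both. *)
    exists (if odd j then 1 else 0) => //; exists (size l).
      by rewrite /= -sx xlr size_cat leq_addr.
    rewrite -sx xlr size_cat subwordD addrC.
    rewrite (sturm_limit_word_suffix (omega_lim _) _ ls); last by case: (odd j).
    by rewrite subrK (sturm_limit_word_prefix (omega_lim _) rs).
  move=> [j _ [k _ <-]]; exists (omega j); first exact: omegaS.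
  by exists (- k%:Z + 1).
move=> A A1 [N hN].
have [g g1 Ag] := local_rule A1 (locally_constant_onS hN).
have [D D1 gD] := mxsum_word_bound g N.+1.*2.+1.
split; last first.
  by move=> j; exact: (cocycle_decay alpha01 alpha_irrational g1 Ag (omega_lim j)).
have [l l0 hl] := lnprod_sturm_word_ratio alpha01 alpha_irrational g1 D1 gD.
exists l => j.
apply: (cocycle_growth alpha01 alpha_irrational g1 Ag (omega_lim j) D1 gD).
exact: (lnprod_affix_bound alpha01 alpha_irrational g1 D1 gD l0 hl).
Qed.
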